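(* Let $N\ge 1$ be an integer, $f_s>0$, let $x(t)$ be an input signal with Fourier transform $X(f)$, and let $\mathbf{g}=(g_0,\dots,g_{N-1})\in\mathbb{R}^N$ be the gain-mismatch sequence, where $g_n$ is the relative gain mismatch of the $n$th of the $N$ sub-ADCs of an interleaved ADC of total rate $f_s$. Let $y^{\mathrm{id}}(t)=x(t)\sum_{k\in\mathbb{Z}}\delta\left(t-\frac{k}{f_s}\right)$ be the ideally sampled output, with Fourier transform $Y^{\mathrm{id}}(f)$, and let the output of the interleaved ADC with gain mismatches be $$y^{\mathrm{g}}(t)=x(t)\sum_{k\in\mathbb{Z}}(1+g_{k\bmod N})\,\delta\left(t-\frac{k}{f_s}\right)=y^{\mathrm{id}}(t)+x(t)\sum_{k\in\mathbb{Z}}g_{k\bmod N}\,\delta\left(t-\frac{k}{f_s}\right).$$ Then the Fourier transform $Y^{\mathrm{g}}$ of $y^{\mathrm{g}}$ is $$Y^{\mathrm{g}}(f)=Y^{\mathrm{id}}(f)+X(f)\ast f_s\sum_{k\in\mathbb{Z}}\tilde{g}_{k\bmod N}\,\delta\left(f-k\frac{f_s}{N}\right),$$ where $\tilde{\mathbf{g}}$ is the normalized DFT of $\mathbf{g}$ and $\ast$ is convolution in the variable $f$.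
   Context: The Fourier transform is $X(f)=\int x(t)e^{-2\pi j f t}\,dt$, with $j$ the imaginary unit, and $\delta$ is the Dirac distribution. For $\mathbf{u}\in\mathbb{C}^N$ with entries $u_0,\dots,u_{N-1}$, the normalized DFT is $\tilde u_k=\frac1N\sum_{n=0}^{N-1}e^{-2\pi j kn/N}u_n$ for $k=0,\dots,N-1$. The index $k\bmod N$ is taken in $\{0,\dots,N-1\}$. *)

(* Defs.v *)
From Stdlib Require Import Reals ZArith Lra Lia.
From Coquelicot Require Import Coquelicot.
Open Scope R_scope.
Open Scope C_scope.

(** * Complex-valued functions of a real variable *)

(** [cis th] is e^{j th}. *)
Definition cis (th : R) : C := (cos th, sin th).

Definition CRe (phi : R -> C) (t : R) : R := Re (phi t).
Definition CIm (phi : R -> C) (t : R) : R := Im (phi t).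

Definition CDerive_n (phi : R -> C) (n : nat) (t : R) : C :=
  (Derive_n (CRe phi) n t, Derive_n (CIm phi) n t).

Definition Cintegral (F : R -> C) : C :=
  RInt_gen (V := C_R_CompleteNormedModule) F
    (Rbar_locally m_infty) (Rbar_locally p_infty).

Definition fourier (phi : R -> C) (f : R) : C :=
  Cintegral (fun t => phi t * cis (- (2 * PI * f * t))).

Definition CSeries (u : nat -> C) : C :=
  (Series (fun n => Re (u n)), Series (fun n => Im (u n))).

(** Two-sided series, as the limit of the symmetric partial sums; every use
    below on a test function is absolutely convergent. *)
Definition sumZ (u : Z -> C) : C :=
  u 0%Z + CSeries (fun n => u (Z.of_nat (S n)) + u (- Z.of_nat (S n))%Z).

(** * Tempered distributions on the real line *)

Definition schwartz (phi : R -> C) : Prop :=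
  (forall (n : nat) (t : R),
      ex_derive_n (CRe phi) n t /\ ex_derive_n (CIm phi) n t) /\
  (forall m n : nat, exists B : R, forall t : R,
      (Rabs t ^ m * Cmod (CDerive_n phi n t) <= B)%R).

(** Distributions are functionals on test functions.  They are total on
    [R -> C], so that [mulD x T] makes sense for a combination [T] of Dirac
    masses and a function [x] that is continuous but not smooth; only their
    values on Schwartz functions matter. *)
Definition distr : Type := (R -> C) -> C.

Definition eqD (T U : distr) : Prop :=
  forall phi : R -> C, schwartz phi -> T phi = U phi.

(** Linearity, and continuity for the Schwartz seminorms. *)
Definition tempered (T : distr) : Prop :=
  (forall (a : C) (phi psi : R -> C), schwartz phi -> schwartz psi ->
      T (fun t => a * phi t + psi t) = a * T phi + T psi) /\
  (exists (m : nat) (K : R), forall (phi : R -> C) (B : R), schwartz phi ->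
      (forall (i j : nat) (t : R), (i <= m)%nat -> (j <= m)%nat ->
          (Rabs t ^ i * Cmod (CDerive_n phi j t) <= B)%R) ->
      (Cmod (T phi) <= K * B)%R).

Definition diracD (a : R) : distr := fun phi => phi a.
Definition addD (T U : distr) : distr := fun phi => T phi + U phi.
Definition scalD (c : C) (T : distr) : distr := fun phi => c * T phi.
Definition sumZD (T : Z -> distr) : distr :=
  fun phi => sumZ (fun k => T k phi).
Definition mulD (x : R -> C) (T : distr) : distr :=
  fun phi => T (fun t => x t * phi t).

(** The distribution defined by the function [x]. *)
Definition regD (x : R -> C) : distr :=
  fun phi => Cintegral (fun t => x t * phi t).

(** Fourier transform by transposition: on [regD x] with [x] integrable it is,
    by Fubini, the function [fourier x]. *)
Definition fourierD (T : distr) : distr := fun phi => T (fourier phi).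

(** [W] is the convolution of the tempered distributions [U] and [V].
    The formula <U * V, phi> = <V_s, <U_f, phi(f + s)>> pairs [V] with a
    function of [s] that is smooth of slow growth but in general not Schwartz,
    so that [V] is first truncated to the rapidly decreasing distributions
    eta(. / n) V, with eta(0) = 1, and n tends to infinity; the limit must
    exist for every test function, and be the same for all cut-offs [eta].
    When s |-> <U_f, phi(f + s)> is Schwartz for every test function [phi] the
    untruncated formula is recovered. *)
Definition is_convD (U V W : distr) : Prop :=
  tempered U /\ tempered V /\ tempered W /\
  forall eta phi : R -> C, schwartz eta -> eta 0%R = 1 -> schwartz phi ->
    filterlim
      (fun n : nat =>
         V (fun s => eta (s / INR (S n))%R * U (fun f => phi (f + s)%R)))
      eventually (locally (W phi)).

(** * Signals and sequences *)

(** Continuity and polynomial growth, so that the values x(k / fs) are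
    meaningful and the sampled signal is a tempered distribution. *)
Definition signal (x : R -> C) : Prop :=
  (forall t : R, continuous x t) /\
  (exists (m : nat) (A : R), forall t : R,
      (Cmod (x t) <= A * (1 + Rabs t) ^ m)%R).

(** A vector of length [N] is a function on [nat] of which only the entries
    0, ..., N-1 are used; [modN N k] is k mod N, in {0, ..., N-1}. *)
Definition modN (N : nat) (k : Z) : nat := Z.to_nat (k mod Z.of_nat N).

(** Normalized DFT ([sum_n u p] is the sum of u 0, ..., u p). *)
Definition dft (N : nat) (u : nat -> C) (k : nat) : C :=
  / RtoC (INR N) *
  sum_n (fun n => cis (- (2 * PI * INR k * INR n / INR N)) * u n) (N - 1).

(* Main.v *)
Require Import Defs.
From Stdlib Require Import Reals ZArith Lra Lia FunctionalExtensionality.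
From Coquelicot Require Import Coquelicot.
Open Scope R_scope.
Open Scope C_scope.

(** Put [h = x * fourier phi] and [T = N / fs].  Translating [phi] by [s] multiplies
    its Fourier transform by a wave, so the regularized pairing defining the
    convolution is [fs * sum_k gt_k eta(k / (T n)) int h(t) e^{2 pi j t k / T} dt].
    Expanding the DFT and substituting [t = T u + p / fs] turns it into a finite
    combination, over the residues [p], of sums
    [sum_k eta(k / (T n)) int h_p(u) e^{2 pi j k u} du].  Each of these is the
    integral over a period of the 1-periodization of [h_p] against the kernel
    [D_n(u) = sum_k eta(k / (T n)) e^{2 pi j k u}].  Two summations by parts give
    [|D_n(u)| <= C n / (1 + (n u)^2)], so [D_n], which has mean [eta(0) = 1], is an
    approximate identity, and the limit is [sum_m h_p(m)]; Fourier inversion is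
    never needed.  Regrouping by residues gives [sum_k g_{k mod N} h(k / fs)]. *)

(** * Limits and continuity in C *)

(** The obstacle is that [x] is merely continuous. Then [h] is continuous and decays, but its
    Fourier integrals at the points [k / T] are controlled only by a uniform bound, so the sum over
    [k] converges absolutely through the cut-off alone and the limit cannot be taken term by term.
    Smoothness is therefore drawn from [eta]: at step [d = fs / (N * INR (S n))] its second
    differences have size [d ^ 2], and this produces the decay of the kernel at scale [d]. All
    convergence is measured against one function, [lor x = 1 / (1 + x ^ 2)]. It is integrable,
    summable along any lattice, changed by at most a constant factor under a fixed translation or
    dilation, and its primitive [atan] makes every tail explicit. In the same spirit functionals are
    controlled by weighted sup norms on continuous functions, the class in which [fourier phi] is
    shown to lie: it decays to any order, and of these orders two are spent on [lor] and the others
    on the growth of [x]. *)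

Definition tendsC (u : nat -> C) (l : C) : Prop :=
  forall eps : R, (0 < eps)%R ->
    exists n0 : nat, forall n, (n0 <= n)%nat -> (Cmod (u n - l) < eps)%R.

Lemma ball_C_of_Cmod (x y : C) (eps : R) :
  (Cmod (y - x) < eps)%R -> ball x eps y.
Proof.
intros H. split; apply Rle_lt_trans with (2 := H).
- apply (re_le_Cmod (y - x)).
- apply Rle_trans with (2 := Rmax_Cmod (y - x)). apply Rmax_r.
Qed.

(** Balls of the uniform structure of [C] are squares, so the modulus can exceed the radius by a
    factor up to sqrt 2; the crude factor 2 is enough for limits. *)
Lemma Cmod_of_ball_C (x y : C) (eps : R) :
  ball x eps y -> (Cmod (y - x) < 2 * eps)%R.
Proof.
intros [H1 H2].
assert (Hs : (sqrt 2 <= 3 / 2)%R).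
{ rewrite <- (sqrt_Rsqr (3/2)) by lra. apply sqrt_le_1; unfold Rsqr; lra. }
assert (HM : (Rmax (Rabs (fst (y - x)%C)) (Rabs (snd (y - x)%C)) < eps)%R)
  by (apply Rmax_lub_lt; [exact H1 | exact H2]).
generalize (Cmod_2Rmax (y - x)) (Rmax_l (Rabs (fst (y - x)%C)) (Rabs (snd (y - x)%C)))
  (Rabs_pos (fst (y - x)%C)).
nra.
Qed.

Lemma filterlim_tendsC (u : nat -> C) (l : C) :
  filterlim u eventually (locally (T := C_UniformSpace) l) <-> tendsC u l.
Proof.
split.
- intros H eps He.
  destruct (proj1 (filterlim_locally (F := eventually) (U := C_UniformSpace) u l) H
     (mkposreal (eps / 2) ltac:(lra))) as [n0 Hn].
  exists n0. intros n Hle. specialize (Hn n Hle). apply Cmod_of_ball_C in Hn.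
  simpl in Hn. lra.
- intros H.
  apply (proj2 (filterlim_locally (F := eventually) (U := C_UniformSpace) u l)).
  intros eps. destruct (H eps (cond_pos eps)) as [n0 Hn].
  exists n0. intros n Hle. apply ball_C_of_Cmod. apply Hn, Hle.
Qed.

Lemma continuous_C_eps (f : R -> C) (t : R) :
  continuous (U := C_UniformSpace) f t <->
  forall eps : R, (0 < eps)%R -> exists d : R, (0 < d)%R /\
    forall s, (Rabs (s - t) < d)%R -> (Cmod (f s - f t) < eps)%R.
Proof.
split.
- intros H eps He.
  destruct (proj1 (filterlim_locally (U := C_UniformSpace) f (f t)) H
     (mkposreal (eps / 2) ltac:(lra))) as [d Hd].
  exists d. split. apply cond_pos. intros s Hs. specialize (Hd s Hs).
  apply Cmod_of_ball_C in Hd. simpl in Hd. lra.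
- intros H. apply (proj2 (filterlim_locally (U := C_UniformSpace) f (f t))).
  intros eps. destruct (H eps (cond_pos eps)) as [d [Hd Hs]].
  exists (mkposreal d Hd). intros s Hb. apply ball_C_of_Cmod. apply Hs, Hb.
Qed.

Lemma continuous_C_pair (f : R -> C) (t : R) :
  continuous (U := C_UniformSpace) f t <->
  continuous (fun s => Re (f s)) t /\ continuous (fun s => Im (f s)) t.
Proof.
split.
- intros H. split.
  + apply (continuous_comp f fst). exact H. apply continuous_fst.
  + apply (continuous_comp f snd). exact H. apply continuous_snd.
- intros [H1 H2]. apply (proj2 (filterlim_locally (U := C_UniformSpace) f (f t))).
  intros eps.
  generalize (proj1 (filterlim_locally _ _) H1 eps) (proj1 (filterlim_locally _ _) H2 eps).
  intros A B. generalize (filter_and _ _ A B). apply filter_imp.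
  intros s [P Q]. split; assumption.
Qed.

Notation continuousC f := (forall t : R, continuous (U := C_UniformSpace) (f : R -> C) t).

Lemma continuousC_const (c : C) : continuousC (fun _ => c).
Proof. intros t. apply continuous_const. Qed.

Lemma continuous_C_plus (f g : R -> C) (t : R) :
  continuous (U := C_UniformSpace) f t -> continuous (U := C_UniformSpace) g t ->
  continuous (U := C_UniformSpace) (fun t => f t + g t) t.
Proof.
intros Hf Hg. apply continuous_C_pair in Hf. apply continuous_C_pair in Hg.
apply continuous_C_pair. destruct Hf, Hg. split.
- apply (continuous_plus (V := R_NormedModule) (fun s => Re (f s)) (fun s => Re (g s))); assumption.
- apply (continuous_plus (V := R_NormedModule) (fun s => Im (f s)) (fun s => Im (g s))); assumption.
Qed.

Lemma continuous_C_mult (f g : R -> C) (t : R) :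
  continuous (U := C_UniformSpace) f t -> continuous (U := C_UniformSpace) g t ->
  continuous (U := C_UniformSpace) (fun t => f t * g t) t.
Proof.
intros Hf Hg. apply continuous_C_pair in Hf. apply continuous_C_pair in Hg.
apply continuous_C_pair. destruct Hf as [F1 F2], Hg as [G1 G2].
assert (M : forall a b : R -> R, continuous a t -> continuous b t ->
   continuous (fun s => (a s * b s)%R) t)
  by (intros; apply (continuous_mult (K := R_AbsRing)); assumption).
split; simpl; unfold Re, Im in *.
- apply (continuous_minus (V := R_NormedModule)
    (fun s => fst (f s) * fst (g s))%R (fun s => snd (f s) * snd (g s))%R); apply M; assumption.
- apply (continuous_plus (V := R_NormedModule)
    (fun s => fst (f s) * snd (g s))%R (fun s => snd (f s) * fst (g s))%R); apply M; assumption.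
Qed.

Lemma continuous_C_comp_lin (f : R -> C) (a b : R) :
  continuousC f -> continuousC (fun t => f (a * t + b)%R).
Proof.
intros H t. apply (continuous_comp (fun t => a * t + b)%R f); [|apply H].
apply (continuous_plus (V := R_NormedModule)).
- apply (continuous_scal_r (V := R_NormedModule) a). apply continuous_id.
- apply continuous_const.
Qed.

Lemma continuousC_cis (w b : R) : continuousC (fun t => cis (w * t + b)).
Proof.
apply (continuous_C_comp_lin cis).
intros t. apply continuous_C_pair. split; unfold cis; simpl.
- apply continuous_cos.
- apply continuous_sin.
Qed.

Lemma Cmod_cis (t : R) : Cmod (cis t) = 1%R.
Proof.
transitivity (sqrt 1); [|apply sqrt_1]. unfold Cmod, cis; simpl.
apply (f_equal sqrt). generalize (sin2_cos2 t). unfold Rsqr. lra.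
Qed.

Lemma cis_add (a b : R) : cis (a + b) = cis a * cis b.
Proof.
unfold cis. rewrite cos_plus, sin_plus. unfold Cmult; simpl. f_equal; ring.
Qed.

Lemma cis_0 : cis 0 = 1.
Proof. unfold cis. rewrite cos_0, sin_0. reflexivity. Qed.

Lemma cis_2PI_IZR (k : Z) : cis (2 * PI * IZR k) = 1.
Proof.
assert (H : forall n : nat, cis (2 * PI * INR n) = 1).
{ intros n. replace (2 * PI * INR n)%R with (0 + 2 * INR n * PI)%R by ring.
  unfold cis. rewrite cos_period, sin_period, cos_0, sin_0. reflexivity. }
destruct (Z_le_gt_dec 0 k) as [h|h].
- rewrite <- (Z2Nat.id k h), <- INR_IZR_INZ. apply H.
- assert (E : cis (2 * PI * IZR k) * cis (2 * PI * INR (Z.to_nat (- k))) = 1).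
  { rewrite <- cis_add, INR_IZR_INZ, Z2Nat.id, opp_IZR by lia.
    rewrite <- cis_0. f_equal. ring. }
  rewrite H in E. rewrite <- E. ring.
Qed.

Lemma tendsC_ext (u v : nat -> C) (l : C) :
  (forall n, u n = v n) -> tendsC u l -> tendsC v l.
Proof.
intros E H eps He. destruct (H eps He) as [n0 Hn]. exists n0. intros n Hle.
rewrite <- E. apply Hn, Hle.
Qed.

Lemma tendsC_const (l : C) : tendsC (fun _ => l) l.
Proof.
intros eps He. exists 0%nat. intros n _.
replace (l - l) with (RtoC 0) by ring. rewrite Cmod_0. exact He.
Qed.

Lemma tendsC_plus (u v : nat -> C) (l m : C) :
  tendsC u l -> tendsC v m -> tendsC (fun n => u n + v n) (l + m).
Proof.
intros Hu Hv eps He.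
destruct (Hu (eps / 2)%R ltac:(lra)) as [n1 H1].
destruct (Hv (eps / 2)%R ltac:(lra)) as [n2 H2].
exists (max n1 n2). intros n Hn.
replace (u n + v n - (l + m)) with ((u n - l) + (v n - m)) by ring.
generalize (Cmod_triangle (u n - l) (v n - m)) (H1 n ltac:(lia)) (H2 n ltac:(lia)). lra.
Qed.

Lemma tendsC_scal (c : C) (u : nat -> C) (l : C) :
  tendsC u l -> tendsC (fun n => c * u n) (c * l).
Proof.
intros Hu eps He.
assert (Hc : (0 < Cmod c + 1)%R) by (generalize (Cmod_ge_0 c); lra).
destruct (Hu (eps / (Cmod c + 1))%R) as [n1 H1].
{ apply Rdiv_lt_0_compat; lra. }
exists n1. intros n Hn. replace (c * u n - c * l) with (c * (u n - l)) by ring.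
rewrite Cmod_mult. specialize (H1 n Hn).
apply Rmult_lt_compat_r with (r := (Cmod c + 1)%R) in H1; [|lra].
unfold Rdiv in H1. rewrite Rmult_assoc, Rinv_l, Rmult_1_r in H1 by lra.
generalize (Cmod_ge_0 (u n - l)). nra.
Qed.

Lemma tendsC_unique (u : nat -> C) (l m : C) :
  tendsC u l -> tendsC u m -> l = m.
Proof.
intros Hl Hm.
destruct (Req_dec (Cmod (l - m)) 0) as [E|E].
- apply Cmod_eq_0 in E. replace l with (l - m + m) by ring. rewrite E. ring.
- exfalso. assert (P : (0 < Cmod (l - m))%R) by (generalize (Cmod_ge_0 (l - m)); lra).
  destruct (Hl (Cmod (l - m) / 2)%R ltac:(lra)) as [n1 H1].
  destruct (Hm (Cmod (l - m) / 2)%R ltac:(lra)) as [n2 H2].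
  generalize (H1 (max n1 n2) ltac:(lia)) (H2 (max n1 n2) ltac:(lia)).
  generalize (Cmod_triangle (u (max n1 n2) - m) (- (u (max n1 n2) - l))).
  replace (u (max n1 n2) - m + - (u (max n1 n2) - l)) with (l - m) by ring.
  rewrite Cmod_opp. lra.
Qed.

Lemma tendsC_0_bound (u : nat -> C) (b : nat -> R) :
  (forall n, (Cmod (u n) <= b n)%R) -> is_lim_seq b 0 -> tendsC u 0.
Proof.
intros H Hb eps He. apply is_lim_seq_spec in Hb.
destruct (Hb (mkposreal eps He)) as [n0 Hn]. exists n0. intros n Hle.
specialize (Hn n Hle). simpl in Hn. replace (u n - 0) with (u n) by ring.
rewrite Rminus_0_r in Hn. generalize (H n) (Rle_abs (b n)). lra.
Qed.

Lemma tendsC_of_minus (u v : nat -> C) (l : C) :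
  tendsC u l -> tendsC (fun n => v n - u n) 0 -> tendsC v l.
Proof.
intros Hu Hv. replace l with (l + 0) by ring.
apply tendsC_ext with (fun n => u n + (v n - u n)). intros; ring.
apply tendsC_plus; assumption.
Qed.

Lemma tendsC_Cmod_le (u : nat -> C) (l : C) (B : R) :
  tendsC u l -> (forall n, (Cmod (u n) <= B)%R) -> (Cmod l <= B)%R.
Proof.
intros Hu HB. apply Rnot_lt_le. intros Hlt.
destruct (Hu (Cmod l - B)%R ltac:(lra)) as [n H].
specialize (H n ltac:(lia)). specialize (HB n).
generalize (Cmod_triangle (u n) (- (u n - l))). rewrite Cmod_opp.
replace (u n + - (u n - l)) with l by ring. lra.
Qed.

Lemma tendsC_shift (u : nat -> C) (l : C) (p : nat -> nat) :
  (forall n, (n <= p n)%nat) -> tendsC u l -> tendsC (fun n => u (p n)) l.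
Proof.
intros Hp H eps He. destruct (H eps He) as [n0 Hn]. exists n0. intros n Hle.
apply Hn. generalize (Hp n). lia.
Qed.

Lemma tendsC_Re_Im (u : nat -> C) (l : C) :
  is_lim_seq (fun n => Re (u n)) (Re l) -> is_lim_seq (fun n => Im (u n)) (Im l) ->
  tendsC u l.
Proof.
intros H1 H2. apply filterlim_tendsC.
apply (proj2 (filterlim_locally (F := eventually) (U := C_UniformSpace) u l)).
intros eps.
generalize (proj1 (filterlim_locally _ _) H1 eps) (proj1 (filterlim_locally _ _) H2 eps).
intros A B. generalize (filter_and _ _ A B). apply filter_imp.
intros s [P Q]. split; assumption.
Qed.

(** * Two-sided series *)

(** The Lorentzian, derivative of [atan]: the common majorant for all two-sided series and all
    integrals over the line. *)
Definition lor (x : R) : R := (/ (1 + x ^ 2))%R.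

Lemma lor_pos (x : R) : (0 < lor x)%R.
Proof. apply Rinv_0_lt_compat. generalize (pow2_ge_0 x). lra. Qed.

Lemma lor_le_1 (x : R) : (lor x <= 1)%R.
Proof.
unfold lor. rewrite <- Rinv_1. apply Rinv_le_contravar. lra. generalize (pow2_ge_0 x); lra.
Qed.

Lemma lor_0 : lor 0 = 1%R.
Proof. unfold lor. field. Qed.

Lemma lor_opp (x : R) : lor (- x) = lor x.
Proof. unfold lor. f_equal. ring. Qed.

Lemma lor_mult (x : R) : (lor x * (1 + x ^ 2) = 1)%R.
Proof. unfold lor. field. generalize (pow2_ge_0 x); lra. Qed.

Lemma le_lor (x a B : R) : (a * (1 + x ^ 2) <= B)%R -> (a <= B * lor x)%R.
Proof.
intros H. apply Rmult_le_compat_r with (r := lor x) in H.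
- rewrite Rmult_assoc, (Rmult_comm (1 + x ^ 2)), lor_mult in H. lra.
- left; apply lor_pos.
Qed.

Lemma continuous_lor (x : R) : continuous lor x.
Proof.
apply continuity_pt_filterlim. unfold lor. reg. simpl. nra.
Qed.

Lemma is_RInt_lor (a b : R) : is_RInt lor a b (atan b - atan a)%R.
Proof.
apply (is_RInt_derive atan lor).
- intros x _. replace (lor x) with (/ (1 + x²))%R.
  apply is_derive_atan. unfold lor, Rsqr. f_equal. ring.
- intros x _. apply continuous_lor.
Qed.

(** Mean value theorem for [atan], whose derivative [lor] decreases on the half-line. This is the
    integral test, with the integral already evaluated. *)
Lemma atan_diff_ge (a b : R) :
  (0 <= a <= b)%R -> ((b - a) * lor b <= atan b - atan a)%R.
Proof.
intros [Ha Hb].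
destruct (MVT_gen atan a b lor) as [c [Hc E]].
- intros x _. replace (lor x) with (/ (1 + x²))%R.
  apply is_derive_atan. unfold lor, Rsqr. f_equal. ring.
- intros x _. apply continuity_pt_filterlim. apply (continuous_atan x).
- rewrite E, Rmult_comm. rewrite Rmin_left, Rmax_right in Hc by lra.
  apply Rmult_le_compat_r. lra. unfold lor. apply Rinv_le_contravar; nra.
Qed.

(** The left side is [atan (/ x)], and [atan] has slope at most 1. *)
Lemma PI2_minus_atan_le (x : R) : (0 < x)%R -> (PI / 2 - atan x <= / x)%R.
Proof.
intros Hx. rewrite <- atan_inv by assumption.
assert (Hi : (0 < / x)%R) by (apply Rinv_0_lt_compat; assumption).
destruct (MVT_gen atan 0 (/ x) lor) as [c [Hc E]].
- intros y _. replace (lor y) with (/ (1 + y²))%R.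
  apply is_derive_atan. unfold lor, Rsqr. f_equal. ring.
- intros y _. apply continuity_pt_filterlim. apply (continuous_atan y).
- rewrite atan_0 in E. generalize (lor_le_1 c). nra.
Qed.

Lemma atan_lt_PI2 (x : R) : (atan x < PI / 2)%R.
Proof. apply atan_bound. Qed.

Lemma is_lim_seq_atan_tail (d : R) :
  (0 < d)%R -> is_lim_seq (fun n => PI / 2 - atan (d * INR n))%R 0.
Proof.
intros Hd. apply is_lim_seq_incr_1.
apply is_lim_seq_le_le with (fun _ => 0%R) (fun n => / d * / INR (S n))%R.
- intros n. split.
  + generalize (atan_lt_PI2 (d * INR (S n))). lra.
  + rewrite <- Rinv_mult. apply PI2_minus_atan_le.
    apply Rmult_lt_0_compat. lra. apply lt_0_INR. lia.
- apply is_lim_seq_const.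
- replace (Finite 0) with (Rbar_mult (/ d)%R 0) by (simpl; f_equal; ring).
  apply is_lim_seq_scal_l. apply (is_lim_seq_incr_1 (fun n => / INR n)%R).
  apply is_lim_seq_spec. intros eps.
  generalize (proj2 (is_lim_seq_spec _ _) is_lim_seq_INR (/ eps)%R).
  intros [n0 Hn]. exists n0. intros n Hle. specialize (Hn n Hle).
  assert (He : (0 < / eps)%R) by (apply Rinv_0_lt_compat, cond_pos).
  rewrite Rminus_0_r, Rabs_pos_eq.
  + rewrite <- (Rinv_inv eps). apply Rinv_lt_contravar; nra.
  + left. apply Rinv_0_lt_compat. lra.
Qed.

(** * Symmetric partial sums and their tails *)

Fixpoint symsum (u : Z -> C) (n : nat) : C :=
  match n with
  | O => u 0%Z
  | S p => symsum u p + (u (Z.of_nat (S p)) + u (- Z.of_nat (S p))%Z)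
  end.

(** The lattice step [d] is kept apart from the constant [B] because the kernel estimate lets [d]
    tend to 0 and has to follow how the bounds depend on it. *)
Definition dominatedZ (d B : R) (u : Z -> C) : Prop :=
  forall k : Z, (Cmod (u k) <= B * lor (d * IZR k))%R.

Lemma dominatedZ_nonneg (d B : R) (u : Z -> C) : dominatedZ d B u -> (0 <= B)%R.
Proof.
intros H. generalize (H 0%Z) (Cmod_ge_0 (u 0%Z)). rewrite Rmult_0_r, lor_0. lra.
Qed.

(** The pair of terms at [m + 1] and [-(m + 1)] has modulus at most [2 * B * lor (d * (m + 1))],
    which is at most [2 * B / d] times the increment of [atan] over one lattice step; the increments
    telescope. *)
Lemma symsum_diff_le (d B : R) (u : Z -> C) (n m : nat) :
  (0 < d)%R -> dominatedZ d B u -> (n <= m)%nat ->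
  (Cmod (symsum u m - symsum u n) <=
     2 * B / d * (atan (d * INR m) - atan (d * INR n)))%R.
Proof.
intros Hd H Hnm. assert (HB := dominatedZ_nonneg _ _ _ H).
induction Hnm as [|m Hnm IH].
- replace (symsum u n - symsum u n) with (RtoC 0) by ring. rewrite Cmod_0. lra.
- cbn [symsum].
  set (a := u (Z.of_nat (S m))). set (b := u (- Z.of_nat (S m))%Z).
  replace (symsum u m + (a + b) - symsum u n) with ((symsum u m - symsum u n) + (a + b))
    by ring.
  assert (Ha := H (Z.of_nat (S m))). assert (Hb := H (- Z.of_nat (S m))%Z).
  rewrite opp_IZR, Ropp_mult_distr_r_reverse, lor_opp in Hb.
  rewrite <- INR_IZR_INZ in Ha, Hb. fold a in Ha. fold b in Hb.
  generalize (Cmod_triangle (symsum u m - symsum u n) (a + b)) (Cmod_triangle a b).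
  assert (K : (d * lor (d * INR (S m)) <= atan (d * INR (S m)) - atan (d * INR m))%R).
  { replace d with (d * INR (S m) - d * INR m)%R at 1 by (rewrite S_INR; ring).
    apply atan_diff_ge. rewrite S_INR. generalize (pos_INR m). nra. }
  assert (K2 : (2 * B * lor (d * INR (S m)) <=
     2 * B / d * (atan (d * INR (S m)) - atan (d * INR m)))%R).
  { replace (2 * B * lor (d * INR (S m)))%R with (2 * B / d * (d * lor (d * INR (S m))))%R
      by (field; lra).
    apply Rmult_le_compat_l; [|exact K].
    apply Rmult_le_pos. lra. left. apply Rinv_0_lt_compat, Hd. }
  lra.
Qed.

(** Twice the integral of [B * lor (d * t)] over [t >= n]. *)
Definition tailZ (d B : R) (n : nat) : R := (2 * B / d * (PI / 2 - atan (d * INR n)))%R.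

Lemma tailZ_lim (d B : R) : (0 < d)%R -> is_lim_seq (tailZ d B) 0.
Proof.
intros Hd. replace (Finite 0) with (Rbar_mult (2 * B / d)%R 0) by (simpl; f_equal; ring).
apply is_lim_seq_scal_l. apply is_lim_seq_atan_tail, Hd.
Qed.

Lemma symsum_diff_le_tail (d B : R) (u : Z -> C) (n m : nat) :
  (0 < d)%R -> dominatedZ d B u -> (n <= m)%nat ->
  (Cmod (symsum u m - symsum u n) <= tailZ d B n)%R.
Proof.
intros Hd H Hnm. apply Rle_trans with (1 := symsum_diff_le d B u n m Hd H Hnm).
apply Rmult_le_compat_l.
- assert (HB := dominatedZ_nonneg _ _ _ H).
  apply Rmult_le_pos. lra. left. apply Rinv_0_lt_compat, Hd.
- generalize (atan_lt_PI2 (d * INR m)). lra.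
Qed.

(** [sum_n] runs over the indices 0 to [n], hence over [n + 1] pairs; this is why [symsum] is taken
    at [S n]. *)
Lemma symsum_Re (u : Z -> C) (n : nat) :
  Re (symsum u (S n)) = (Re (u 0%Z) +
    sum_n (fun n => Re (u (Z.of_nat (S n)) + u (- Z.of_nat (S n))%Z)) n)%R.
Proof.
induction n as [|n IH].
- rewrite sum_O. reflexivity.
- rewrite sum_Sn. unfold plus; cbn -[Z.of_nat symsum].
  change (Re (symsum u (S n)) + Re (u (Z.of_nat (S (S n))) + u (- Z.of_nat (S (S n)))%Z)%C
    = Re (u 0%Z) + (sum_n (fun n => Re (u (Z.of_nat (S n)) + u (- Z.of_nat (S n))%Z)%C) n +
     Re (u (Z.of_nat (S (S n))) + u (- Z.of_nat (S (S n)))%Z)%C))%R.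
  rewrite IH. ring.
Qed.

Lemma symsum_Im (u : Z -> C) (n : nat) :
  Im (symsum u (S n)) = (Im (u 0%Z) +
    sum_n (fun n => Im (u (Z.of_nat (S n)) + u (- Z.of_nat (S n))%Z)) n)%R.
Proof.
induction n as [|n IH].
- rewrite sum_O. reflexivity.
- rewrite sum_Sn. unfold plus; cbn -[Z.of_nat symsum].
  change (Im (symsum u (S n)) + Im (u (Z.of_nat (S (S n))) + u (- Z.of_nat (S (S n)))%Z)%C
    = Im (u 0%Z) + (sum_n (fun n => Im (u (Z.of_nat (S n)) + u (- Z.of_nat (S n))%Z)%C) n +
     Im (u (Z.of_nat (S (S n))) + u (- Z.of_nat (S (S n)))%Z)%C))%R.
  rewrite IH. ring.
Qed.

Lemma Series_of_lim (a s : nat -> R) (c l : R) :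
  (forall n, s (S n) = c + sum_n a n)%R -> is_lim_seq s l -> (c + Series a = l)%R.
Proof.
intros E H. apply is_lim_seq_incr_1 in H.
rewrite (is_series_unique a (l - c)). ring.
unfold is_series.
apply (is_lim_seq_ext (fun n => s (S n) - c)%R (sum_n a) (l - c)%R).
- intros n. rewrite E. ring.
- apply is_lim_seq_minus'. exact H. apply is_lim_seq_const.
Qed.

Lemma Im_le_Cmod (c : C) : (Rabs (Im c) <= Cmod c)%R.
Proof. apply Rle_trans with (2 := Rmax_Cmod c). apply Rmax_r. Qed.

(** [p] stands for [Re] or [Im], both 1-Lipschitz for the modulus: [CSeries] is defined by
    coordinates, so completeness is used on real sequences. *)
Lemma symsum_cauchy (d B : R) (u : Z -> C) (p : C -> R) :
  (forall a b : C, (Rabs (p a - p b) <= Cmod (a - b))%R) ->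
  (0 < d)%R -> dominatedZ d B u -> ex_finite_lim_seq (fun n => p (symsum u n)).
Proof.
intros Hp Hd H. apply ex_lim_seq_cauchy_corr. intros eps.
assert (L := tailZ_lim d B Hd). apply is_lim_seq_spec in L.
destruct (L (pos_div_2 eps)) as [n0 Hn]. exists n0.
assert (K : forall n, (n0 <= n)%nat ->
   (Rabs (p (symsum u n) - p (symsum u n0)) < eps / 2)%R).
{ intros n Hle. apply Rle_lt_trans with (1 := Hp _ _).
  apply Rle_lt_trans with (1 := symsum_diff_le_tail d B u n0 n Hd H Hle).
  specialize (Hn n0 (le_n _)). simpl in Hn. rewrite Rminus_0_r in Hn.
  apply Rle_lt_trans with (2 := Hn). apply Rle_abs. }
intros n m Hle Hle'. generalize (K n Hle) (K m Hle').
intros A1 A2. apply Rabs_def2 in A1. apply Rabs_def2 in A2. apply Rabs_def1; lra.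
Qed.

Lemma tends_sumZ (d B : R) (u : Z -> C) :
  (0 < d)%R -> dominatedZ d B u -> tendsC (symsum u) (sumZ u).
Proof.
intros Hd H.
destruct (symsum_cauchy d B u Re) as [l Hl]; try assumption.
{ intros a b. apply (re_le_Cmod (a - b)). }
destruct (symsum_cauchy d B u Im) as [m Hm]; try assumption.
{ intros a b. apply (Im_le_Cmod (a - b)). }
apply tendsC_Re_Im.
- replace (Re (sumZ u)) with l. exact Hl. symmetry.
  apply (Series_of_lim _ (fun n => Re (symsum u n))). apply symsum_Re. exact Hl.
- replace (Im (sumZ u)) with m. exact Hm. symmetry.
  apply (Series_of_lim _ (fun n => Im (symsum u n))). apply symsum_Im. exact Hm.
Qed.

Lemma sumZ_tail_le (d B : R) (u : Z -> C) (n : nat) :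
  (0 < d)%R -> dominatedZ d B u -> (Cmod (sumZ u - symsum u n) <= tailZ d B n)%R.
Proof.
intros Hd H.
apply tendsC_Cmod_le with (fun m => symsum u (m + n) + - symsum u n).
- apply tendsC_plus; [|apply tendsC_const].
  apply (tendsC_shift (symsum u) _ (fun m => (m + n)%nat)). intros; lia.
  apply (tends_sumZ d B); assumption.
- intros m. apply (symsum_diff_le_tail d B u n (m + n) Hd H). lia.
Qed.

(** The term at 0 contributes [B], and the tail beyond it [2 * B / d * (PI / 2)]. *)
Lemma sumZ_bound (d B : R) (u : Z -> C) :
  (0 < d)%R -> dominatedZ d B u -> (Cmod (sumZ u) <= B * (1 + PI / d))%R.
Proof.
intros Hd H. generalize (sumZ_tail_le d B u 0 Hd H). unfold tailZ.
simpl. rewrite Rmult_0_r, atan_0.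
generalize (H 0%Z). rewrite Rmult_0_r, lor_0.
generalize (Cmod_triangle (sumZ u - u 0%Z) (u 0%Z)).
replace (sumZ u - u 0%Z + u 0%Z) with (sumZ u) by ring.
replace (2 * B / d * (PI / 2 - 0))%R with (B * (PI / d))%R by (field; lra). lra.
Qed.

(** [sumZ] is a total function, so every identity about it goes through this lemma: domination
    guarantees that the value is the limit of the symmetric sums, and the limit is then computed. *)
Lemma sumZ_unique (d B : R) (u : Z -> C) (l : C) :
  (0 < d)%R -> dominatedZ d B u -> tendsC (symsum u) l -> sumZ u = l.
Proof.
intros Hd H Hl. apply tendsC_unique with (symsum u); [|exact Hl].
apply (tends_sumZ d B); assumption.
Qed.

Lemma sumZ_ext (u v : Z -> C) : (forall k, u k = v k) -> sumZ u = sumZ v.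
Proof. intros H. f_equal. apply functional_extensionality, H. Qed.

Lemma symsum_plus (u v : Z -> C) (n : nat) :
  symsum (fun k => u k + v k) n = symsum u n + symsum v n.
Proof. induction n as [|n IH]; cbn [symsum]. reflexivity. rewrite IH. ring. Qed.

Lemma symsum_scal (c : C) (u : Z -> C) (n : nat) :
  symsum (fun k => c * u k) n = c * symsum u n.
Proof. induction n as [|n IH]; cbn [symsum]. reflexivity. rewrite IH. ring. Qed.

Lemma dominatedZ_plus (d B B' : R) (u v : Z -> C) :
  dominatedZ d B u -> dominatedZ d B' v -> dominatedZ d (B + B') (fun k => u k + v k).
Proof.
intros Hu Hv k. generalize (Hu k) (Hv k) (Cmod_triangle (u k) (v k)). lra.
Qed.

Lemma dominatedZ_mult (d B M : R) (c u : Z -> C) :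
  (forall k, (Cmod (c k) <= M)%R) -> dominatedZ d B u ->
  dominatedZ d (M * B) (fun k => c k * u k).
Proof.
intros Hc Hu k. rewrite Cmod_mult, Rmult_assoc.
apply Rmult_le_compat; try apply Cmod_ge_0. apply Hc. apply Hu.
Qed.

Lemma sumZ_plus (d B B' : R) (u v : Z -> C) :
  (0 < d)%R -> dominatedZ d B u -> dominatedZ d B' v ->
  sumZ (fun k => u k + v k) = sumZ u + sumZ v.
Proof.
intros Hd Hu Hv. apply (sumZ_unique d (B + B')); [exact Hd| |].
- apply dominatedZ_plus; assumption.
- apply tendsC_ext with (fun n => symsum u n + symsum v n).
  intros n. symmetry. apply symsum_plus.
  apply tendsC_plus; eapply tends_sumZ; eassumption.
Qed.

Lemma sumZ_scal (d B : R) (c : C) (u : Z -> C) :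
  (0 < d)%R -> dominatedZ d B u -> sumZ (fun k => c * u k) = c * sumZ u.
Proof.
intros Hd Hu. apply (sumZ_unique d (Cmod c * B)); [exact Hd| |].
- apply (dominatedZ_mult d B (Cmod c) (fun _ => c)). intros; lra. exact Hu.
- apply tendsC_ext with (fun n => c * symsum u n).
  intros n. symmetry. apply symsum_scal.
  apply tendsC_scal; eapply tends_sumZ; eassumption.
Qed.

Lemma lor_INR_lim (d : R) : (0 < d)%R -> is_lim_seq (fun n => lor (d * INR n)) 0.
Proof.
intros Hd. apply is_lim_seq_incr_1.
(* The constant [/ 2] makes the factor [2 * B / d] of the tail equal to [/ d]; one term times [d] is
   at most one increment of [atan], hence at most the whole remaining tail. *)
apply is_lim_seq_le_le with (fun _ => 0%R) (fun n => tailZ d (/ 2) n).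
- intros n. split. left; apply lor_pos. unfold tailZ.
  assert (K : (d * lor (d * INR (S n)) <= atan (d * INR (S n)) - atan (d * INR n))%R).
  { replace d with (d * INR (S n) - d * INR n)%R at 1 by (rewrite S_INR; ring).
    apply atan_diff_ge. rewrite S_INR. generalize (pos_INR n). nra. }
  replace (lor (d * INR (S n))) with (/ d * (d * lor (d * INR (S n))))%R by (field; lra).
  replace (2 * / 2 / d)%R with (/ d)%R by (field; lra).
  apply Rmult_le_compat_l. left; apply Rinv_0_lt_compat, Hd.
  generalize (atan_lt_PI2 (d * INR (S n))). lra.
- apply is_lim_seq_const.
- apply tailZ_lim, Hd.
Qed.

Lemma dominatedZ_lim_pos (d B : R) (u : Z -> C) :
  (0 < d)%R -> dominatedZ d B u -> tendsC (fun n => u (Z.of_nat n)) 0.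
Proof.
intros Hd H. apply tendsC_0_bound with (fun n => B * lor (d * INR n))%R.
- intros n. rewrite INR_IZR_INZ. apply H.
- replace (Finite 0) with (Rbar_mult B 0) by (simpl; f_equal; ring).
  apply is_lim_seq_scal_l, lor_INR_lim, Hd.
Qed.

Lemma dominatedZ_lim_neg (d B : R) (u : Z -> C) :
  (0 < d)%R -> dominatedZ d B u -> tendsC (fun n => u (- Z.of_nat n)%Z) 0.
Proof.
intros Hd H. apply (dominatedZ_lim_pos d B (fun k => u (- k)%Z) Hd).
intros k. generalize (H (- k)%Z). rewrite opp_IZR, Ropp_mult_distr_r_reverse, lor_opp. trivial.
Qed.

Lemma symsum_shift (u : Z -> C) (n : nat) :
  symsum (fun k => u (k + 1)%Z) n =
  symsum u n + (u (Z.of_nat (S n)) - u (- Z.of_nat n)%Z).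
Proof.
induction n as [|n IH].
- simpl. ring.
- cbn [symsum]. rewrite IH.
  replace (Z.of_nat (S n) + 1)%Z with (Z.of_nat (S (S n))) by lia.
  replace (- Z.of_nat (S n) + 1)%Z with (- Z.of_nat n)%Z by lia. ring.
Qed.

(** Symmetric sums are not invariant under translation: shifting the window gains [u (n + 1)] and
    loses [u (- n)]. Both boundary terms tend to 0 by domination. *)
Lemma sumZ_shift (d B : R) (u : Z -> C) :
  (0 < d)%R -> dominatedZ d B u -> dominatedZ d B (fun k => u (k + 1)%Z) ->
  sumZ (fun k => u (k + 1)%Z) = sumZ u.
Proof.
intros Hd Hu Hv. apply (sumZ_unique d B); [exact Hd|exact Hv|].
apply tendsC_of_minus with (symsum u). apply (tends_sumZ d B); assumption.
apply tendsC_ext with (fun n => u (Z.of_nat (S n)) + (-(1)) * u (- Z.of_nat n)%Z).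
- intros n. rewrite symsum_shift. ring.
- replace (RtoC 0) with (0 + (-(1)) * 0) by ring.
  apply tendsC_plus.
  + apply (tendsC_shift (fun n => u (Z.of_nat n)) 0 S). intros; lia.
    apply (dominatedZ_lim_pos d B); assumption.
  + apply tendsC_scal. apply (dominatedZ_lim_neg d B); assumption.
Qed.

(** * Finite sums, windows and residue classes *)

Fixpoint csum (u : nat -> C) (n : nat) : C :=
  match n with O => 0 | S p => csum u p + u p end.

Lemma csum_ext (u v : nat -> C) (n : nat) :
  (forall i, (i < n)%nat -> u i = v i) -> csum u n = csum v n.
Proof.
induction n as [|n IH]; intros H; cbn [csum]. reflexivity.
rewrite IH, H; try reflexivity; try lia. intros; apply H; lia.
Qed.

Lemma csum_app (u : nat -> C) (n m : nat) :
  csum u (n + m) = csum u n + csum (fun i => u (n + i)%nat) m.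
Proof.
induction m as [|m IH].
- rewrite Nat.add_0_r. simpl. ring.
- rewrite Nat.add_succ_r. cbn [csum]. rewrite IH. ring.
Qed.

Lemma csum_plus (u v : nat -> C) (n : nat) :
  csum (fun i => u i + v i) n = csum u n + csum v n.
Proof. induction n as [|n IH]; cbn [csum]. ring. rewrite IH. ring. Qed.

Lemma csum_scal (c : C) (u : nat -> C) (n : nat) :
  csum (fun i => c * u i) n = c * csum u n.
Proof. induction n as [|n IH]; cbn [csum]. ring. rewrite IH. ring. Qed.

Lemma sum_n_csum (u : nat -> C) (n : nat) : sum_n u n = csum u (S n).
Proof.
induction n as [|n IH].
- rewrite sum_O. simpl. ring.
- rewrite sum_Sn, IH. reflexivity.
Qed.

Lemma tendsC_csum (u : nat -> nat -> C) (l : nat -> C) (n : nat) :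
  (forall p, (p < n)%nat -> tendsC (fun i => u i p) (l p)) ->
  tendsC (fun i => csum (u i) n) (csum l n).
Proof.
induction n as [|n IH]; intros H; cbn [csum].
- apply tendsC_const.
- apply tendsC_plus. apply IH. intros; apply H; lia. apply H. lia.
Qed.

Lemma sumZ_csum (d : R) (B : nat -> R) (u : nat -> Z -> C) (n : nat) :
  (0 < d)%R -> (forall p, (p < n)%nat -> dominatedZ d (B p) (u p)) ->
  sumZ (fun k => csum (fun p => u p k) n) = csum (fun p => sumZ (u p)) n.
Proof.
intros Hd H.
assert (K : (exists B', dominatedZ d B' (fun k => csum (fun p => u p k) n)) /\
   sumZ (fun k => csum (fun p => u p k) n) = csum (fun p => sumZ (u p)) n).
{ induction n as [|n IH].
  - split.
    + exists 0%R. intros k. simpl. rewrite Cmod_0. lra.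
    + simpl. apply (sumZ_unique d 0). exact Hd. intros k. rewrite Cmod_0; lra.
      apply tendsC_ext with (fun _ => RtoC 0); [|apply tendsC_const].
      intros m. induction m as [|m IHm]; cbn [symsum]. reflexivity. rewrite <- IHm. ring.
  - destruct IH as [[B' HB'] E]. intros; apply H; lia. split.
    + exists (B' + B n)%R. cbn [csum]. apply dominatedZ_plus. exact HB'. apply H; lia.
    + cbn [csum]. rewrite <- E. eapply sumZ_plus. exact Hd. exact HB'. apply H; lia. }
apply K.
Qed.

(** Sums over blocks of consecutive integers, cut and glued by [window_app]. They are needed because
    sums symmetric within each residue class do not add up to a symmetric sum. *)
Definition window (u : Z -> C) (a : Z) (n : nat) : C := csum (fun i => u (a + Z.of_nat i)%Z) n.

Lemma window_app (u : Z -> C) (a : Z) (n m : nat) :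
  window u a (n + m) = window u a n + window u (a + Z.of_nat n)%Z m.
Proof.
unfold window. rewrite csum_app. f_equal. apply csum_ext. intros i _. f_equal. lia.
Qed.

Lemma symsum_window (u : Z -> C) (n : nat) :
  symsum u n = window u (- Z.of_nat n) (2 * n + 1).
Proof.
induction n as [|n IH].
- unfold window. simpl. ring.
- cbn [symsum]. rewrite IH.
  replace (2 * S n + 1)%nat with (1 + ((2 * n + 1) + 1))%nat by lia.
  rewrite (window_app u _ 1), (window_app u _ (2 * n + 1)).
  replace (- Z.of_nat (S n) + Z.of_nat 1)%Z with (- Z.of_nat n)%Z by lia.
  replace (- Z.of_nat n + Z.of_nat (2 * n + 1))%Z with (Z.of_nat (S n)) by lia.
  assert (W1 : forall a, window u a 1 = u a).
  { intros a. unfold window. cbn [csum]. rewrite Z.add_0_r. ring. }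
  rewrite !W1. ring.
Qed.

(** The integers [p + m * N] with [0 <= p < N] and [-n <= m <= n] tile the block from [- n * N] to
    [n * N + N - 1]. The induction adds one period of length [N] at each end. *)
Lemma symsum_residues (N : nat) (u : Z -> C) (n : nat) :
  csum (fun p => symsum (fun m => u (Z.of_nat p + m * Z.of_nat N)%Z) n) N =
  window u (- Z.of_nat (n * N)) ((2 * n + 1) * N).
Proof.
induction n as [|n IH].
- cbn [symsum]. replace ((2 * 0 + 1) * N)%nat with N by lia. unfold window.
  apply csum_ext. intros i _. f_equal; lia.
- cbn [symsum]. rewrite csum_plus, csum_plus, IH.
  replace ((2 * S n + 1) * N)%nat with (N + ((2 * n + 1) * N + N))%nat by lia.
  rewrite window_app, window_app.
  replace (- Z.of_nat (S n * N) + Z.of_nat N)%Z with (- Z.of_nat (n * N))%Z by lia.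
  replace (csum (fun i => u (Z.of_nat i + Z.of_nat (S n) * Z.of_nat N)%Z) N)
    with (window u (- Z.of_nat (n * N) + Z.of_nat ((2 * n + 1) * N)) N).
  2: { apply csum_ext. intros i _. f_equal. lia. }
  replace (csum (fun i => u (Z.of_nat i + - Z.of_nat (S n) * Z.of_nat N)%Z) N)
    with (window u (- Z.of_nat (S n * N)) N).
  2: { apply csum_ext. intros i _. f_equal. lia. }
  ring.
Qed.

Lemma window_tends_0 (d B : R) (u : Z -> C) (s : nat -> nat) (m : nat) :
  (0 < d)%R -> dominatedZ d B u -> (forall n, (n <= s n)%nat) ->
  tendsC (fun n => window u (Z.of_nat (s n)) m) 0.
Proof.
intros Hd H Hs. unfold window. replace (RtoC 0) with (csum (fun _ => RtoC 0) m).
- apply (tendsC_csum (fun n i => u (Z.of_nat (s n) + Z.of_nat i)%Z)). intros p _.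
  apply tendsC_ext with (fun n => u (Z.of_nat (s n + p))).
  intros n. f_equal. lia.
  apply (tendsC_shift (fun n => u (Z.of_nat n)) 0 (fun n => (s n + p)%nat)).
  intros n. specialize (Hs n). lia. apply (dominatedZ_lim_pos d B); assumption.
- induction m as [|m IH]; cbn [csum]. reflexivity. rewrite IH. ring.
Qed.

(** The block of [symsum_residues] exceeds the symmetric block of radius [n * N] by the [N - 1]
    terms that follow [n * N]; their number is fixed and each tends to 0. *)
Lemma sumZ_residues (N : nat) (d B : R) (u : Z -> C) (d' : R) (B' : nat -> R) :
  (1 <= N)%nat -> (0 < d)%R -> (0 < d')%R -> dominatedZ d B u ->
  (forall p, (p < N)%nat ->
     dominatedZ d' (B' p) (fun m => u (Z.of_nat p + m * Z.of_nat N)%Z)) ->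
  csum (fun p => sumZ (fun m => u (Z.of_nat p + m * Z.of_nat N)%Z)) N = sumZ u.
Proof.
intros HN Hd Hd' H H'.
apply tendsC_unique with
  (fun n => csum (fun p => symsum (fun m => u (Z.of_nat p + m * Z.of_nat N)%Z) n) N).
- apply tendsC_csum. intros p Hp. apply (tends_sumZ d' (B' p)). exact Hd'. apply H', Hp.
- apply tendsC_of_minus with (fun n => symsum u (n * N)).
  + apply (tendsC_shift (symsum u) _ (fun n => (n * N)%nat)). intros n; nia.
    apply (tends_sumZ d B); assumption.
  + apply tendsC_ext with (fun n => window u (Z.of_nat (n * N + 1)) (N - 1)).
    * intros n. rewrite symsum_residues, symsum_window.
      replace ((2 * n + 1) * N)%nat with ((2 * (n * N) + 1) + (N - 1))%nat by lia.
      rewrite window_app.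
      replace (- Z.of_nat (n * N) + Z.of_nat (2 * (n * N) + 1))%Z
        with (Z.of_nat (n * N + 1)) by lia. ring.
    * apply (window_tends_0 d B u (fun n => (n * N + 1)%nat)); try assumption.
      intros n; nia.
Qed.

(** * Integrals of continuous functions *)

Definition CI (f : R -> C) (a b : R) : C := RInt (V := C_R_CompleteNormedModule) f a b.

Lemma norm_C_R (z : C) : norm (V := C_R_NormedModule) z = Cmod z.
Proof.
change (norm (V := C_R_NormedModule) z)
  with (sqrt (Rabs (fst z) ^ 2 + Rabs (snd z) ^ 2)).
unfold Cmod. rewrite !pow2_abs. reflexivity.
Qed.

Lemma CI_correct (f : R -> C) (a b : R) :
  continuousC f -> is_RInt (V := C_R_NormedModule) f a b (CI f a b).
Proof.
intros H. apply (RInt_correct (V := C_R_CompleteNormedModule)).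
apply (ex_RInt_continuous (V := C_R_CompleteNormedModule)). intros z _. apply H.
Qed.

Lemma CI_unique (f : R -> C) (a b : R) (l : C) :
  is_RInt (V := C_R_NormedModule) f a b l -> CI f a b = l.
Proof. apply (is_RInt_unique (V := C_R_CompleteNormedModule)). Qed.

Lemma CI_ext (f g : R -> C) (a b : R) : (forall t, f t = g t) -> CI f a b = CI g a b.
Proof. intros H. f_equal. apply functional_extensionality, H. Qed.

Lemma CI_plus (f g : R -> C) (a b : R) :
  continuousC f -> continuousC g -> CI (fun t => f t + g t) a b = CI f a b + CI g a b.
Proof.
intros Hf Hg. apply CI_unique.
apply (is_RInt_plus (V := C_R_NormedModule)); apply CI_correct; assumption.
Qed.

(** The integral is taken in [C] as a real normed module, which offers real scalars only; a complex
    factor is handled through real and imaginary parts. *)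
Lemma CI_scal (c : C) (f : R -> C) (a b : R) :
  continuousC f -> CI (fun t => c * f t) a b = c * CI f a b.
Proof.
intros Hf. apply CI_unique. assert (H := CI_correct f a b Hf).
assert (H1 := is_RInt_fct_extend_fst (U := R_NormedModule) (V := R_NormedModule) _ _ _ _ H).
assert (H2 := is_RInt_fct_extend_snd (U := R_NormedModule) (V := R_NormedModule) _ _ _ _ H).
apply (is_RInt_fct_extend_pair (U := R_NormedModule) (V := R_NormedModule)).
- apply (is_RInt_minus (V := R_NormedModule) (fun t => fst c * fst (f t))%R (fun t => snd c * snd (f t))%R).
  + apply (is_RInt_scal (V := R_NormedModule)). exact H1.
  + apply (is_RInt_scal (V := R_NormedModule)). exact H2.
- apply (is_RInt_plus (V := R_NormedModule) (fun t => fst c * snd (f t))%R (fun t => snd c * fst (f t))%R).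
  + apply (is_RInt_scal (V := R_NormedModule)). exact H2.
  + apply (is_RInt_scal (V := R_NormedModule)). exact H1.
Qed.

Lemma CI_Chasles (f : R -> C) (a b c : R) :
  continuousC f -> CI f a c = CI f a b + CI f b c.
Proof.
intros Hf. apply CI_unique.
apply (is_RInt_Chasles (V := C_R_NormedModule) f a b c); apply CI_correct; assumption.
Qed.

Lemma CI_le (f : R -> C) (g : R -> R) (a b l : R) :
  (a <= b)%R -> continuousC f -> (forall t, (a <= t <= b)%R -> (Cmod (f t) <= g t)%R) ->
  is_RInt g a b l -> (Cmod (CI f a b) <= l)%R.
Proof.
intros Hab Hf H Hg. rewrite <- norm_C_R.
apply (norm_RInt_le (V := C_R_NormedModule) f g a b _ _ Hab); [|apply CI_correct, Hf|exact Hg].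
intros t Ht. rewrite norm_C_R. apply H, Ht.
Qed.

Lemma CI_le_const (f : R -> C) (a b M : R) :
  (a <= b)%R -> continuousC f -> (forall t, (a <= t <= b)%R -> (Cmod (f t) <= M)%R) ->
  (Cmod (CI f a b) <= (b - a) * M)%R.
Proof.
intros Hab Hf H. apply (CI_le f (fun _ => M)); try assumption.
apply (is_RInt_const (V := R_NormedModule)).
Qed.

Lemma CI_comp_lin (f : R -> C) (u v a b : R) :
  continuousC f -> CI f (u * a + v) (u * b + v) = RtoC u * CI (fun t => f (u * t + v)%R) a b.
Proof.
intros Hf. rewrite <- CI_scal by (apply continuous_C_comp_lin, Hf).
symmetry. apply CI_unique.
apply (is_RInt_ext (V := C_R_NormedModule)) with
  (fun t => scal (V := C_R_ModuleSpace) u (f (u * t + v)%R)).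
- intros t _. apply injective_projections; simpl; unfold scal; simpl; unfold mult; simpl; ring.
- apply (is_RInt_comp_lin (V := C_R_NormedModule)). apply CI_correct, Hf.
Qed.

Lemma CI_minus (f g : R -> C) (a b : R) :
  continuousC f -> continuousC g -> CI (fun t => f t - g t) a b = CI f a b - CI g a b.
Proof.
intros Hf Hg. replace (CI f a b - CI g a b) with (CI f a b + (-(1)) * CI g a b) by ring.
rewrite <- CI_scal by exact Hg. rewrite <- CI_plus; try assumption.
apply CI_ext. intros; ring.
intros t. apply continuous_C_mult. apply continuousC_const. apply Hg.
Qed.

Lemma CI_swap (f : R -> C) (a b : R) : continuousC f -> CI f b a = - CI f a b.
Proof.
intros Hf. apply CI_unique. apply (is_RInt_swap (V := C_R_NormedModule)).
apply CI_correct, Hf.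
Qed.

(** * Improper integrals of dominated functions *)

Definition dominatedR (B : R) (f : R -> C) : Prop :=
  forall t : R, (Cmod (f t) <= B * lor t)%R.

Lemma dominatedR_nonneg (B : R) (f : R -> C) : dominatedR B f -> (0 <= B)%R.
Proof. intros H. generalize (H 0%R) (Cmod_ge_0 (f 0%R)). rewrite lor_0. lra. Qed.

Lemma CI_dominated (B : R) (f : R -> C) (a b : R) :
  continuousC f -> dominatedR B f -> (a <= b)%R ->
  (Cmod (CI f a b) <= B * (atan b - atan a))%R.
Proof.
intros Hc Hf Hab. apply (CI_le f (fun t => B * lor t)%R); try assumption.
- intros t _. apply Hf.
- apply (is_RInt_scal (V := R_NormedModule)). apply is_RInt_lor.
Qed.

(** The endpoints may come in either order, since the Cauchy criterion compares two truncations
    whose endpoints are not ordered. *)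
Lemma CI_dominated_far (B : R) (f : R -> C) (A a b : R) :
  continuousC f -> dominatedR B f -> (0 < A)%R ->
  ((A < a /\ A < b) \/ (a < - A /\ b < - A))%R ->
  (Cmod (CI f a b) <= B / A)%R.
Proof.
intros Hc Hf HA.
assert (HB := dominatedR_nonneg _ _ Hf).
assert (T : (B * (PI / 2 - atan A) <= B / A)%R).
{ apply Rmult_le_compat_l. exact HB. apply PI2_minus_atan_le, HA. }
assert (M : forall x y, (x <= y)%R -> (atan x <= atan y)%R).
{ intros x y [h|h]. left; apply atan_increasing, h. subst; lra. }
assert (K : forall a b, (a <= b)%R -> ((A < a /\ A < b) \/ (a < - A /\ b < - A))%R ->
   (Cmod (CI f a b) <= B / A)%R).
{ intros x y Hxy H.
  apply Rle_trans with (1 := CI_dominated B f x y Hc Hf Hxy).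
  apply Rle_trans with (2 := T). apply Rmult_le_compat_l. exact HB.
  destruct H as [[H1 H2]|[H1 H2]].
  - generalize (M A x ltac:(lra)) (atan_lt_PI2 y). lra.
  - generalize (M y (- A)%R ltac:(lra)) (atan_lt_PI2 (- x)).
    rewrite !atan_opp. lra. }
intros H. destruct (Rle_dec a b) as [h|h].
- apply K; assumption.
- rewrite CI_swap by exact Hc. rewrite Cmod_opp. apply K. lra. tauto.
Qed.

(** [RInt_gen] always has a value; that this value is the integral follows from the Cauchy criterion
    for truncations to [[a, b]], two of which differ by two far pieces of modulus at most [B / A]
    each. *)
Lemma Cintegral_correct (B : R) (f : R -> C) :
  continuousC f -> dominatedR B f ->
  is_RInt_gen (V := C_R_NormedModule) f (Rbar_locally m_infty) (Rbar_locally p_infty)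
    (Cintegral f).
Proof.
intros Hc Hf. apply (RInt_gen_correct (V := C_R_CompleteNormedModule)).
assert (HB := dominatedR_nonneg _ _ Hf).
apply (Hierarchy.filterlimi_locally_cauchy (U := C_R_CompleteNormedModule)).
- apply filter_forall. intros [a b]. split.
  + exists (CI f a b). apply CI_correct, Hc.
  + intros y1 y2 H1 H2. simpl in H1, H2.
    rewrite <- (CI_unique _ _ _ _ H1). apply CI_unique, H2.
(* Then [A * eps = 2 * B + eps > 2 * B], so the two far pieces together stay below [eps]; the
   summand 1 keeps [A] positive when [B = 0]. *)
- intros eps. set (A := (2 * B / eps + 1)%R).
  assert (HA : (0 < A)%R).
  { unfold A. assert (0 <= 2 * B / eps)%R; [|lra].
    apply Rmult_le_pos. lra. left; apply Rinv_0_lt_compat, cond_pos. }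
  assert (HA2 : (2 * (B / A) < eps)%R).
  { replace (2 * (B / A))%R with (2 * B / A)%R by (field; lra).
    apply Rmult_lt_reg_r with A. exact HA. unfold Rdiv. rewrite Rmult_assoc, Rinv_l by lra.
    unfold A. generalize (cond_pos eps). intros He.
    replace (eps * (2 * B / eps + 1))%R with (2 * B + eps)%R by (field; lra). lra. }
  exists (fun ab => fst ab < - A /\ A < snd ab)%R. split.
  + exists (fun a => a < - A)%R (fun b => A < b)%R.
    * exists (- A)%R. trivial.
    * exists A. trivial.
    * intros x y Hx Hy. split; assumption.
  + intros [a b] [a' b'] [H1 H2] [H1' H2'] u v Hu Hv. simpl in *.
    apply ball_C_of_Cmod. apply CI_unique in Hu. apply CI_unique in Hv. subst u v.
    rewrite (CI_Chasles f a' a b'), (CI_Chasles f a b b') by exact Hc.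
    replace (CI f a' a + (CI f a b + CI f b b') - CI f a b) with (CI f a' a + CI f b b') by ring.
    generalize (Cmod_triangle (CI f a' a) (CI f b b'))
      (CI_dominated_far B f A a' a Hc Hf HA ltac:(right; lra))
      (CI_dominated_far B f A b b' Hc Hf HA ltac:(left; lra)). lra.
Qed.

(** The endpoints are arbitrary sequences because truncations occur at half-integers and at affine
    images of integers, as well as at [- n] and [n]. *)
Lemma tends_Cintegral (B : R) (f : R -> C) (a b : nat -> R) :
  continuousC f -> dominatedR B f ->
  is_lim_seq a m_infty -> is_lim_seq b p_infty ->
  tendsC (fun n => CI f (a n) (b n)) (Cintegral f).
Proof.
intros Hc Hf Ha Hb. apply filterlim_tendsC.
assert (H := Cintegral_correct B f Hc Hf).
apply (proj2 (filterlim_locally (F := eventually) (U := C_UniformSpace) _ _)).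
intros eps. specialize (H (ball (Cintegral f) eps) (locally_ball _ eps)).
destruct H as [P Q HP HQ H].
assert (EP : eventually (fun n => P (a n))) by exact (Ha P HP).
assert (EQ : eventually (fun n => Q (b n))) by exact (Hb Q HQ).
generalize (filter_and _ _ EP EQ). apply filter_imp.
intros n [Pn Qn]. destruct (H _ _ Pn Qn) as [y [Hy By]].
simpl in Hy. apply CI_unique in Hy. rewrite Hy. exact By.
Qed.

Lemma Cintegral_unique (B : R) (f : R -> C) (a b : nat -> R) (l : C) :
  continuousC f -> dominatedR B f ->
  is_lim_seq a m_infty -> is_lim_seq b p_infty ->
  tendsC (fun n => CI f (a n) (b n)) l -> Cintegral f = l.
Proof.
intros Hc Hf Ha Hb. apply tendsC_unique. apply (tends_Cintegral B); assumption.
Qed.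

Lemma is_lim_seq_opp_INR : is_lim_seq (fun n => - INR n)%R m_infty.
Proof. apply (is_lim_seq_opp INR p_infty). apply is_lim_seq_INR. Qed.

Lemma is_lim_seq_lin_p (u v : R) (a : nat -> R) :
  (0 < u)%R -> is_lim_seq a p_infty -> is_lim_seq (fun n => u * a n + v)%R p_infty.
Proof.
intros Hu Ha. apply is_lim_seq_spec. apply is_lim_seq_spec in Ha. intros M.
destruct (Ha ((M - v) / u)%R) as [n0 H]. exists n0. intros n Hn. specialize (H n Hn).
apply Rmult_lt_compat_l with (r := u) in H; [|exact Hu].
replace (u * ((M - v) / u))%R with (M - v)%R in H by (field; lra). lra.
Qed.

Lemma is_lim_seq_lin_m (u v : R) (a : nat -> R) :
  (0 < u)%R -> is_lim_seq a m_infty -> is_lim_seq (fun n => u * a n + v)%R m_infty.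
Proof.
intros Hu Ha. apply is_lim_seq_spec. apply is_lim_seq_spec in Ha. intros M.
destruct (Ha ((M - v) / u)%R) as [n0 H]. exists n0. intros n Hn. specialize (H n Hn).
apply Rmult_lt_compat_l with (r := u) in H; [|exact Hu].
replace (u * ((M - v) / u))%R with (M - v)%R in H by (field; lra). lra.
Qed.

Lemma Cintegral_ext (f g : R -> C) : (forall t, f t = g t) -> Cintegral f = Cintegral g.
Proof. intros H. f_equal. apply functional_extensionality, H. Qed.

Lemma dominatedR_plus (B B' : R) (f g : R -> C) :
  dominatedR B f -> dominatedR B' g -> dominatedR (B + B') (fun t => f t + g t).
Proof.
intros Hu Hv k. generalize (Hu k) (Hv k) (Cmod_triangle (f k) (g k)). lra.
Qed.

Lemma dominatedR_mult (B M : R) (c f : R -> C) :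
  (forall t, (Cmod (c t) <= M)%R) -> dominatedR B f ->
  dominatedR (M * B) (fun t => c t * f t).
Proof.
intros Hc Hu k. rewrite Cmod_mult, Rmult_assoc.
apply Rmult_le_compat; try apply Cmod_ge_0. apply Hc. apply Hu.
Qed.

Lemma Cintegral_bound (B : R) (f : R -> C) :
  continuousC f -> dominatedR B f -> (Cmod (Cintegral f) <= B * PI)%R.
Proof.
intros Hc Hf.
apply tendsC_Cmod_le with (fun n => CI f (- INR n) (INR n)).
- apply (tends_Cintegral B); try assumption. apply is_lim_seq_opp_INR. apply is_lim_seq_INR.
- intros n. apply Rle_trans with (1 := CI_dominated B f (- INR n) (INR n) Hc Hf
    ltac:(generalize (pos_INR n); lra)).
  apply Rmult_le_compat_l. apply (dominatedR_nonneg B f Hf).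
  generalize (atan_bound (INR n)) (atan_bound (- INR n)). lra.
Qed.

Lemma Cintegral_plus (B B' : R) (f g : R -> C) :
  continuousC f -> continuousC g -> dominatedR B f -> dominatedR B' g ->
  Cintegral (fun t => f t + g t) = Cintegral f + Cintegral g.
Proof.
intros Cf Cg Hf Hg.
apply (Cintegral_unique (B + B') _ (fun n => - INR n)%R INR).
- intros t. apply continuous_C_plus. apply Cf. apply Cg.
- apply dominatedR_plus; assumption.
- apply is_lim_seq_opp_INR.
- apply is_lim_seq_INR.
- apply tendsC_ext with (fun n => CI f (- INR n) (INR n) + CI g (- INR n) (INR n)).
  intros n. symmetry. apply CI_plus; assumption.
  apply tendsC_plus; eapply tends_Cintegral; try eassumption;
    solve [apply is_lim_seq_opp_INR | apply is_lim_seq_INR].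
Qed.

Lemma Cintegral_scal (B : R) (c : C) (f : R -> C) :
  continuousC f -> dominatedR B f -> Cintegral (fun t => c * f t) = c * Cintegral f.
Proof.
intros Cf Hf.
apply (Cintegral_unique (Cmod c * B) _ (fun n => - INR n)%R INR).
- intros t. apply continuous_C_mult. apply continuousC_const. apply Cf.
- apply (dominatedR_mult B (Cmod c) (fun _ => c)). intros; lra. exact Hf.
- apply is_lim_seq_opp_INR.
- apply is_lim_seq_INR.
- apply tendsC_ext with (fun n => c * CI f (- INR n) (INR n)).
  intros n. symmetry. apply CI_scal; assumption.
  apply tendsC_scal; eapply tends_Cintegral; try eassumption;
    solve [apply is_lim_seq_opp_INR | apply is_lim_seq_INR].
Qed.

(** With [y = u * t + v] one has [t = (y - v) / u], hence [1 + t ^ 2 <= 1 + 2 * (y ^ 2 + v ^ 2) / u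
    ^ 2], which is at most the stated constant times [1 + y ^ 2]. *)
Lemma lor_comp_lin (u v t : R) :
  (0 < u)%R -> (lor (u * t + v) <= (1 + 2 / u ^ 2 + 2 * v ^ 2 / u ^ 2) * lor t)%R.
Proof.
intros Hu. apply le_lor.
assert (Hw : (0 < / u)%R) by (apply Rinv_0_lt_compat, Hu).
set (y := (u * t + v)%R). set (w := (/ u)%R) in *.
assert (Et : t = (w * (y - v))%R) by (unfold y, w; field; lra).
apply Rmult_le_reg_r with (1 + y ^ 2)%R. nra.
replace (lor y * (1 + t ^ 2) * (1 + y ^ 2))%R with ((lor y * (1 + y ^ 2)) * (1 + t ^ 2))%R by ring.
rewrite lor_mult, Rmult_1_l.
replace (2 / u ^ 2)%R with (2 * w ^ 2)%R by (unfold w; field; lra).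
replace (2 * v ^ 2 / u ^ 2)%R with (2 * v ^ 2 * w ^ 2)%R by (unfold w; field; lra).
rewrite Et. clear Et. clearbody y w. clear Hu.
assert (P : (0 <= w ^ 2)%R) by apply pow2_ge_0.
assert (Q : ((y - v) ^ 2 <= 2 * y ^ 2 + 2 * v ^ 2)%R) by (generalize (pow2_ge_0 (y + v)); nra).
assert (S : (0 <= v ^ 2 * y ^ 2)%R) by (apply Rmult_le_pos; apply pow2_ge_0).
assert (S2 : (0 <= w ^ 2 * (v ^ 2 * y ^ 2))%R) by (apply Rmult_le_pos; assumption).
replace ((w * (y - v)) ^ 2)%R with (w ^ 2 * (y - v) ^ 2)%R by ring.
generalize (Rmult_le_compat_l _ _ _ P Q) (pow2_ge_0 y). nra.
Qed.

Lemma dominatedR_comp_lin (B u v : R) (f : R -> C) :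
  (0 < u)%R -> dominatedR B f ->
  dominatedR (B * (1 + 2 / u ^ 2 + 2 * v ^ 2 / u ^ 2)) (fun t => f (u * t + v)%R).
Proof.
intros Hu Hf t. apply Rle_trans with (1 := Hf _). rewrite Rmult_assoc.
apply Rmult_le_compat_l. apply (dominatedR_nonneg B f Hf). apply lor_comp_lin, Hu.
Qed.

Lemma Cintegral_comp_lin (B u v : R) (f : R -> C) :
  (0 < u)%R -> continuousC f -> dominatedR B f ->
  RtoC u * Cintegral (fun t => f (u * t + v)%R) = Cintegral f.
Proof.
intros Hu Cf Hf. symmetry.
apply (Cintegral_unique B _ (fun n => u * (- INR n) + v)%R (fun n => u * INR n + v)%R);
  try assumption.
- apply is_lim_seq_lin_m. exact Hu. apply is_lim_seq_opp_INR.
- apply is_lim_seq_lin_p. exact Hu. apply is_lim_seq_INR.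
- apply tendsC_ext with (fun n => u * CI (fun t => f (u * t + v)%R) (- INR n) (INR n)).
  + intros n. symmetry. apply CI_comp_lin, Cf.
  + apply tendsC_scal.
    apply (tends_Cintegral _ _ _ _ (continuous_C_comp_lin f u v Cf)
      (dominatedR_comp_lin B u v f Hu Hf)).
    apply is_lim_seq_opp_INR. apply is_lim_seq_INR.
Qed.

(** * Continuity and integration of two-sided series of functions *)

Lemma symsum_continuousC (f : Z -> R -> C) (n : nat) :
  (forall k, continuousC (f k)) -> continuousC (fun t => symsum (fun k => f k t) n).
Proof.
intros H. induction n as [|n IH]; cbn [symsum]; intros t.
- apply H.
- apply continuous_C_plus. apply IH. apply continuous_C_plus; apply H.
Qed.

Lemma CI_symsum (f : Z -> R -> C) (n : nat) (a b : R) :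
  (forall k, continuousC (f k)) ->
  CI (fun t => symsum (fun k => f k t) n) a b = symsum (fun k => CI (f k) a b) n.
Proof.
intros H. induction n as [|n IH]; cbn [symsum].
- reflexivity.
- rewrite CI_plus, CI_plus, IH. reflexivity. apply H. apply H.
  apply (symsum_continuousC f n H). intros t. apply continuous_C_plus; apply H.
Qed.

(** The constant may depend on the radius: the translates [h (u + m)], as sequences in [m], obey a
    common bound only while [u] stays in a bounded set. *)
Definition locally_dominated (d : R) (f : Z -> R -> C) : Prop :=
  forall r : R, exists B : R, forall t, (Rabs t <= r)%R -> dominatedZ d B (fun k => f k t).

(** The tail bound [tailZ d B n] is uniform on bounded sets, so the partial sums converge locally
    uniformly. *)
Lemma sumZ_continuousC (d : R) (f : Z -> R -> C) :
  (0 < d)%R -> (forall k, continuousC (f k)) -> locally_dominated d f ->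
  continuousC (fun t => sumZ (fun k => f k t)).
Proof.
intros Hd Cf Hf t. apply continuous_C_eps. intros eps He.
(* The extra 1 leaves room for a neighbourhood of [t] on which one constant serves. *)
destruct (Hf (Rabs t + 1)%R) as [B HB].
assert (L := tailZ_lim d B Hd). apply is_lim_seq_spec in L.
destruct (L (mkposreal (eps / 3) ltac:(lra))) as [n Hn].
specialize (Hn n (le_n _)). simpl in Hn. rewrite Rminus_0_r in Hn.
assert (Hn' := Rle_lt_trans _ _ _ (Rle_abs _) Hn).
destruct (proj1 (continuous_C_eps _ t) (symsum_continuousC f n Cf t) (eps / 3)%R ltac:(lra))
  as [dl [Hdl H]].
exists (Rmin dl 1). split. apply Rmin_glb_lt; lra.
intros s Hs.
assert (Hs1 : (Rabs (s - t) < dl)%R) by (eapply Rlt_le_trans; [exact Hs|apply Rmin_l]).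
assert (Hs2 : (Rabs (s - t) < 1)%R) by (eapply Rlt_le_trans; [exact Hs|apply Rmin_r]).
assert (Hs3 : (Rabs s <= Rabs t + 1)%R).
{ replace s with ((s - t) + t)%R by ring. generalize (Rabs_triang (s - t) t). lra. }
generalize (sumZ_tail_le d B _ n Hd (HB s Hs3)) (sumZ_tail_le d B _ n Hd (HB t ltac:(lra)))
  (H s Hs1).
set (Ss := sumZ (fun k => f k s)). set (St := sumZ (fun k => f k t)).
set (ss := symsum (fun k => f k s) n). set (st := symsum (fun k => f k t) n).
intros A1 A2 A3.
replace (Ss - St) with ((Ss - ss) + ((ss - st) + - (St - st))) by ring.
generalize (Cmod_triangle (Ss - ss) ((ss - st) + - (St - st)))
  (Cmod_triangle (ss - st) (- (St - st))). rewrite Cmod_opp. lra.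
Qed.

Lemma dominatedZ_CI (d B a b : R) (f : Z -> R -> C) :
  (a <= b)%R -> (forall k, continuousC (f k)) ->
  (forall t, (a <= t <= b)%R -> dominatedZ d B (fun k => f k t)) ->
  dominatedZ d ((b - a) * B) (fun k => CI (f k) a b).
Proof.
intros Hab Cf HB k. rewrite Rmult_assoc. apply CI_le_const. exact Hab. apply Cf.
intros t Ht. apply (HB t Ht).
Qed.

Lemma CI_sumZ (d a b : R) (f : Z -> R -> C) :
  (0 < d)%R -> (a <= b)%R -> (forall k, continuousC (f k)) -> locally_dominated d f ->
  CI (fun t => sumZ (fun k => f k t)) a b = sumZ (fun k => CI (f k) a b).
Proof.
intros Hd Hab Cf Hf. symmetry.
destruct (Hf (Rmax (Rabs a) (Rabs b))) as [B HB'].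
assert (HB : forall t, (a <= t <= b)%R -> dominatedZ d B (fun k => f k t)).
{ intros t Ht. apply HB'. apply RmaxAbs; lra. }
apply (sumZ_unique d ((b - a) * B)). exact Hd. apply dominatedZ_CI; assumption.
assert (CS := sumZ_continuousC d f Hd Cf Hf).
apply tendsC_of_minus with (fun n => CI (fun t => sumZ (fun k => f k t)) a b).
apply tendsC_const.
apply tendsC_0_bound with (fun n => (b - a) * tailZ d B n)%R.
- intros n. rewrite <- CI_symsum by exact Cf.
  rewrite <- CI_minus; [|apply symsum_continuousC, Cf | exact CS].
  apply CI_le_const. exact Hab.
  + intros t. replace (fun t => symsum (fun k => f k t) n - sumZ (fun k => f k t))
      with (fun t => symsum (fun k => f k t) n + (-(1)) * sumZ (fun k => f k t)).
    * apply continuous_C_plus. apply symsum_continuousC, Cf.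
      apply continuous_C_mult. apply continuousC_const. apply CS.
    * apply functional_extensionality. intros s. ring.
  + intros t Ht. rewrite <- Cmod_opp.
    replace (- (symsum (fun k => f k t) n - sumZ (fun k => f k t)))
      with (sumZ (fun k => f k t) - symsum (fun k => f k t) n) by ring.
    apply sumZ_tail_le. exact Hd. apply HB, Ht.
- replace (Finite 0) with (Rbar_mult (b - a)%R 0) by (simpl; f_equal; ring).
  apply is_lim_seq_scal_l, tailZ_lim, Hd.
Qed.

(** * A summability form of the Poisson formula *)

Definition wave (k : Z) (u : R) : C := cis (2 * PI * IZR k * u).

Lemma wave_continuousC (k : Z) : continuousC (wave k).
Proof.
intros t. apply (continuous_ext (fun t => cis (2 * PI * IZR k * t + 0))).
intros s. unfold wave. f_equal. ring. apply continuousC_cis.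
Qed.

Lemma Cmod_wave (k : Z) (u : R) : Cmod (wave k u) = 1%R.
Proof. apply Cmod_cis. Qed.

Lemma wave_add (k l : Z) (u : R) : wave (k + l) u = wave k u * wave l u.
Proof. unfold wave. rewrite <- cis_add, plus_IZR. f_equal. ring. Qed.

(** Integer translations are written [1 * u + IZR m] here and below so that the lemmas on
    [u * t + v] apply syntactically. *)
Lemma wave_period (k m : Z) (u : R) : wave k (1 * u + IZR m) = wave k u.
Proof.
unfold wave.
replace (2 * PI * IZR k * (1 * u + IZR m))%R with (2 * PI * IZR k * u + 2 * PI * IZR (k * m))%R
  by (rewrite mult_IZR; ring).
rewrite cis_add, cis_2PI_IZR. ring.
Qed.

Lemma CI_wave (k : Z) : (k <> 0)%Z -> CI (wave k) (- / 2) (/ 2) = 0.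
Proof.
intros Hk. apply CI_unique.
assert (Hw : (2 * PI * IZR k <> 0)%R).
{ apply Rmult_integral_contrapositive. split. generalize PI_RGT_0; lra.
  apply not_0_IZR, Hk. }
set (w := (2 * PI * IZR k)%R) in *.
assert (Hs : sin (w * / 2) = 0%R).
{ apply sin_eq_0_1. exists k. unfold w. field. }
change (RtoC 0) with ((0, 0)%R : C).
apply (is_RInt_fct_extend_pair (U := R_NormedModule) (V := R_NormedModule)); simpl.
- replace 0%R with (minus (sin (w * / 2) / w) (sin (w * - / 2) / w))%R.
  2: { unfold minus, plus, opp; simpl.
       replace (w * - / 2)%R with (- (w * / 2))%R by ring. rewrite sin_neg, Hs. field. exact Hw. }
  apply (is_RInt_derive (V := R_CompleteNormedModule) (fun t => sin (w * t) / w)%R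
     (fun t => cos (w * t))).
  + intros t _. auto_derive. trivial. field. exact Hw.
  + intros t _. apply (continuous_comp (fun t => w * t)%R cos).
    apply (continuous_scal_r (V := R_NormedModule) w). apply continuous_id. apply continuous_cos.
- replace 0%R with (minus (- cos (w * / 2) / w) (- cos (w * - / 2) / w))%R.
  2: { unfold minus, plus, opp; simpl.
       replace (w * - / 2)%R with (- (w * / 2))%R by ring. rewrite cos_neg. field. exact Hw. }
  apply (is_RInt_derive (V := R_CompleteNormedModule) (fun t => - cos (w * t) / w)%R
     (fun t => sin (w * t))).
  + intros t _. auto_derive. trivial. field. exact Hw.
  + intros t _. apply (continuous_comp (fun t => w * t)%R sin).
    apply (continuous_scal_r (V := R_NormedModule) w). apply continuous_id. apply continuous_sin.
Qed.

Lemma CI_wave_0 : CI (wave 0) (- / 2) (/ 2) = 1.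
Proof.
apply CI_unique. replace (wave 0) with (fun _ : R => RtoC 1).
2: { apply functional_extensionality. intros u. unfold wave.
     rewrite <- cis_0. f_equal. ring. }
assert (H := is_RInt_const (V := C_R_NormedModule) (- / 2) (/ 2) (RtoC 1)).
replace (scal (/ 2 - - / 2)%R (RtoC 1 : C_R_NormedModule)) with (RtoC 1) in H. exact H.
apply injective_projections; simpl; unfold scal; simpl; unfold mult; simpl; field.
Qed.

Lemma sumZ_single (u : Z -> C) : (forall k, k <> 0%Z -> u k = 0) -> sumZ u = u 0%Z.
Proof.
intros H. apply (sumZ_unique 1 (Cmod (u 0%Z))). lra.
- intros k. destruct (Z.eq_dec k 0) as [->|Hk].
  + rewrite Rmult_0_r, lor_0. lra.
  + rewrite H, Cmod_0 by exact Hk. apply Rmult_le_pos. apply Cmod_ge_0. left; apply lor_pos.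
- apply tendsC_ext with (fun _ => u 0%Z); [|apply tendsC_const].
  intros n. induction n as [|n IH]; cbn [symsum]. reflexivity.
  rewrite <- IH, (H (Z.of_nat (S n))), (H (- Z.of_nat (S n))%Z) by lia. ring.
Qed.

Lemma dominatedZ_weaken (d B B' : R) (u : Z -> C) :
  (B <= B')%R -> dominatedZ d B u -> dominatedZ d B' u.
Proof.
intros HB H k. apply Rle_trans with (1 := H k).
apply Rmult_le_compat_r. left; apply lor_pos. exact HB.
Qed.

Lemma lor_translate (x v : R) : (lor (x + v) <= (3 + 2 * v ^ 2) * lor x)%R.
Proof.
generalize (lor_comp_lin 1 v x Rlt_0_1). rewrite Rmult_1_l.
replace (1 + 2 / 1 ^ 2 + 2 * v ^ 2 / 1 ^ 2)%R with (3 + 2 * v ^ 2)%R by field. trivial.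
Qed.

Lemma dominatedZ_shift (d B : R) (u : Z -> C) (m : Z) :
  dominatedZ d B u -> dominatedZ d (B * (3 + 2 * (d * IZR m) ^ 2)) (fun k => u (k + m)%Z).
Proof.
intros H k. apply Rle_trans with (1 := H _). rewrite Rmult_assoc.
apply Rmult_le_compat_l. apply (dominatedZ_nonneg d B u H).
rewrite plus_IZR, Rmult_plus_distr_l. apply lor_translate.
Qed.

Lemma sumZ_shift1 (d B : R) (u : Z -> C) :
  (0 < d)%R -> dominatedZ d B u -> sumZ (fun k => u (k + 1)%Z) = sumZ u.
Proof.
intros Hd H. assert (HB := dominatedZ_nonneg d B u H).
apply (sumZ_shift d (B * (3 + 2 * (d * IZR 1) ^ 2)) u Hd).
- apply (dominatedZ_weaken d B); [|exact H]. generalize (pow2_ge_0 (d * IZR 1)). nra.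
- apply dominatedZ_shift, H.
Qed.

Lemma sumZ_shift_m1 (d B : R) (u : Z -> C) :
  (0 < d)%R -> dominatedZ d B u -> sumZ (fun k => u (k - 1)%Z) = sumZ u.
Proof.
intros Hd H.
rewrite <- (sumZ_shift1 d _ (fun k => u (k - 1)%Z) Hd (dominatedZ_shift d B u (-1) H)).
apply sumZ_ext. intros k. f_equal. lia.
Qed.

(** * The summability kernel as an approximate identity *)

Definition kernel (c : Z -> C) (u : R) : C := sumZ (fun k => c k * wave k u).

Definition diff2 (c : Z -> C) (k : Z) : C := c (k - 1)%Z - 2 * c k + c (k + 1)%Z.

Lemma dominatedZ_wave (d B : R) (c : Z -> C) (u : R) :
  dominatedZ d B c -> dominatedZ d B (fun k => c k * wave k u).
Proof. intros H k. rewrite Cmod_mult, Cmod_wave, Rmult_1_r. apply H. Qed.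

(** Moving the index of [c] by one multiplies the kernel by [wave 1 u] or [wave (-1) u], and
    [wave 1 u + wave (-1) u - 2] is [2 * cos (2 * PI * u) - 2]. Shift invariance of [sumZ] replaces
    the boundary terms of summation by parts. *)
Lemma kernel_diff2 (d B : R) (c : Z -> C) (u : R) :
  (0 < d)%R -> dominatedZ d B c ->
  kernel (diff2 c) u = RtoC (2 * cos (2 * PI * u) - 2) * kernel c u.
Proof.
intros Hd H. set (v := fun k => c k * wave k u).
assert (Hv : dominatedZ d B v) by apply dominatedZ_wave, H.
assert (H1 := dominatedZ_shift d B v 1 Hv). assert (H2 := dominatedZ_shift d B v (-1) Hv).
assert (M : forall a : C, forall k : Z, (Cmod a <= Cmod a)%R) by (intros; lra).
assert (E1 : sumZ (fun k => wave 1 u * v (k - 1)%Z) = wave 1 u * sumZ v).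
{ rewrite (sumZ_scal d _ (wave 1 u) (fun k => v (k - 1)%Z) Hd H2).
  rewrite (sumZ_shift_m1 d B v Hd Hv). reflexivity. }
assert (E2 : sumZ (fun k => wave (-1) u * v (k + 1)%Z) = wave (-1) u * sumZ v).
{ rewrite (sumZ_scal d _ (wave (-1) u) (fun k => v (k + 1)%Z) Hd H1).
  rewrite (sumZ_shift1 d B v Hd Hv). reflexivity. }
assert (E3 := sumZ_scal d B (-(2)) v Hd Hv).
assert (D1 := dominatedZ_mult d _ _ (fun _ => wave 1 u) _ (M _) H2).
assert (D2 := dominatedZ_mult d _ _ (fun _ => wave (-1) u) _ (M _) H1).
assert (D3 := dominatedZ_mult d _ _ (fun _ => -(2)) _ (M _) Hv).
change (dominatedZ d (Cmod (wave 1 u) * (B * (3 + 2 * (d * IZR (-1)) ^ 2))) (fun k => wave 1 u * v (k - 1)%Z)) in D1.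
cbv beta in D2, D3.
change (kernel c u) with (sumZ v).
transitivity (wave 1 u * sumZ v + (wave (-1) u * sumZ v + -(2) * sumZ v)).
- rewrite <- E1, <- E2, <- E3.
  rewrite <- (sumZ_plus d _ _ _ _ Hd D2 D3).
  rewrite <- (sumZ_plus d _ _ _ _ Hd D1 (dominatedZ_plus _ _ _ _ _ D2 D3)).
  apply sumZ_ext. intros k. unfold diff2, v.
  replace (wave 1 u * (c (k - 1)%Z * wave (k - 1) u)) with (c (k - 1)%Z * (wave (k - 1) u * wave 1 u))
    by ring.
  replace (wave (-1) u * (c (k + 1)%Z * wave (k + 1) u))
    with (c (k + 1)%Z * (wave (k + 1) u * wave (-1) u)) by ring.
  rewrite <- !wave_add.
  replace (k - 1 + 1)%Z with k by lia. replace (k + 1 + -1)%Z with k by lia. ring.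
- replace (RtoC (2 * cos (2 * PI * u) - 2)) with (wave 1 u + (wave (-1) u + -(2))). ring.
  unfold wave, cis.
  replace (2 * PI * 1 * u)%R with (2 * PI * u)%R by ring.
  replace (2 * PI * -1 * u)%R with (- (2 * PI * u))%R by ring.
  rewrite cos_neg, sin_neg. apply injective_projections; simpl; ring.
Qed.

(** The right side is [4 * sin (PI * u) ^ 2]. For [0 <= y <= 2] the Taylor bound
    [sin y >= y - y ^ 3 / 6] gives [sin y >= y / 3], and [y = PI * u >= 3 * u]. *)
Lemma one_minus_cos_ge (u : R) :
  (Rabs u <= / 2)%R -> (u ^ 2 <= 2 - 2 * cos (2 * PI * u))%R.
Proof.
assert (K : forall u, (0 <= u <= / 2)%R -> (u ^ 2 <= 2 - 2 * cos (2 * PI * u))%R).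
{ clear u. intros u Hu.
  replace (2 * PI * u)%R with (2 * (PI * u))%R by ring. rewrite cos_2a_sin.
  assert (HP := PI2_3_2). assert (HP4 := PI_4).
  set (y := (PI * u)%R). assert (Hy : (3 * u <= y <= 2)%R) by (unfold y; nra).
  assert (Hs : (y / 3 <= sin y)%R).
  { destruct (pre_sin_bound y 0 ltac:(lra) ltac:(lra)) as [S _].
    apply Rle_trans with (2 := S). unfold sin_approx, sin_term. simpl.
    assert (y ^ 2 <= 4)%R by nra. assert (y * y ^ 2 <= y * 4)%R by nra. simpl in *. nra. }
  assert (u <= sin y)%R by lra. nra. }
intros Hu. apply Rabs_le_between in Hu. destruct (Rle_dec 0 u) as [h|h].
- apply K. lra.
- generalize (K (- u)%R ltac:(lra)).
  replace (2 * PI * - u)%R with (- (2 * PI * u))%R by ring. rewrite cos_neg.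
  replace ((- u) ^ 2)%R with (u ^ 2)%R by ring. trivial.
Qed.

(* Summation by parts twice: the kernel is an approximate identity at scale [d]. *)
Lemma kernel_le (a d B B2 : R) (c : Z -> C) (u : R) :
  (0 < d)%R -> (d <= a)%R -> dominatedZ d B c -> dominatedZ d (B2 * d ^ 2) (diff2 c) ->
  (Rabs u <= / 2)%R ->
  (Cmod (kernel c u) <= (B + B2) * (a + PI) * (/ d * lor (/ d * u + 0)))%R.
Proof.
intros Hd Hda H H2 Hu.
assert (HB := dominatedZ_nonneg _ _ _ H).
assert (HB2 : (0 <= B2)%R).
{ apply Rmult_le_reg_r with (d ^ 2)%R. nra. rewrite Rmult_0_l.
  apply (dominatedZ_nonneg _ _ _ H2). }
assert (K1 := sumZ_bound d B _ Hd (dominatedZ_wave d B c u H)).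
assert (K2 := sumZ_bound d _ _ Hd (dominatedZ_wave d _ _ u H2)).
fold (kernel c u) in K1. fold (kernel (diff2 c) u) in K2.
rewrite (kernel_diff2 d B c u Hd H), Cmod_mult, Cmod_R in K2.
rewrite Rabs_left1 in K2 by (generalize (COS_bound (2 * PI * u)); lra).
assert (L := one_minus_cos_ge u Hu). assert (P := Cmod_ge_0 (kernel c u)).
set (q := Cmod (kernel c u)) in *. clearbody q.
assert (Hi : (0 < / d)%R) by (apply Rinv_0_lt_compat, Hd).
assert (HPI := PI_RGT_0).
(* The hypothesis [d <= a] turns the constant of [sumZ_bound] into a multiple of [/ d] with a factor
   that does not depend on [d]. *)
assert (E : (1 + PI / d <= (a + PI) * / d)%R).
{ replace (1 + PI / d)%R with ((d + PI) * / d)%R by (field; lra).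
  apply Rmult_le_compat_r; lra. }
replace ((B + B2) * (a + PI) * (/ d * lor (/ d * u + 0)))%R
  with (((B + B2) * (a + PI) * / d) * lor (/ d * u + 0))%R by ring.
apply le_lor. rewrite Rplus_0_r.
(* [A1] bounds [q] itself, [A3] bounds [q * (u / d) ^ 2] through the second differences; their sum
   is the bound on [q * (1 + (u / d) ^ 2)] that [le_lor] asks for. *)
assert (A1 : (q <= B * ((a + PI) * / d))%R).
{ apply Rle_trans with (1 := K1). apply Rmult_le_compat_l; lra. }
assert (A2 : (q * u ^ 2 <= B2 * d ^ 2 * ((a + PI) * / d))%R).
{ apply Rle_trans with (B2 * d ^ 2 * (1 + PI / d))%R.
  apply Rle_trans with (2 := K2). rewrite Rmult_comm. apply Rmult_le_compat_r; lra.
  apply Rmult_le_compat_l. apply Rmult_le_pos. lra. apply pow2_ge_0. exact E. }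
assert (A3 : (q * (/ d * u) ^ 2 <= B2 * ((a + PI) * / d))%R).
{ replace (q * (/ d * u) ^ 2)%R with (/ d ^ 2 * (q * u ^ 2))%R by (field; lra).
  replace (B2 * ((a + PI) * / d))%R with (/ d ^ 2 * (B2 * d ^ 2 * ((a + PI) * / d)))%R
    by (field; lra).
  apply Rmult_le_compat_l. left; apply Rinv_0_lt_compat. nra. exact A2. }
lra.
Qed.

(** The rescaled majorant has mass at most [PI] at every scale [d]: this uniformity lets it dominate
    an approximate identity. *)
Lemma is_RInt_lor_scaled (d : R) :
  (0 < d)%R ->
  exists l, (l <= PI)%R /\ is_RInt (fun u => / d * lor (/ d * u + 0))%R (- / 2) (/ 2) l.
Proof.
intros Hd. eexists. split.
2: { apply (is_RInt_comp_lin (V := R_NormedModule) lor (/ d) 0 (- / 2) (/ 2)).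
     apply is_RInt_lor. }
generalize (atan_bound (/ d * / 2 + 0)) (atan_bound (/ d * - / 2 + 0)). lra.
Qed.

(** Where [|u| < delta] the variation of [H] is at most [eps] and the majorant has mass at most
    [M * PI]. Elsewhere [K] is at most [M * d / delta ^ 2] and the variation of [H] at most [2 * S],
    on an interval of length 1. *)
Lemma approximate_identity (d M S eps delta : R) (K H : R -> C) :
  (0 < d)%R -> (0 <= M)%R -> (0 < delta)%R -> (0 <= eps)%R ->
  continuousC K -> continuousC H ->
  (forall u, (Rabs u <= / 2)%R -> (Cmod (K u) <= M * (/ d * lor (/ d * u + 0)))%R) ->
  CI K (- / 2) (/ 2) = 1 ->
  (forall u, (Rabs u <= / 2)%R -> (Cmod (H u) <= S)%R) ->
  (forall u, (Rabs u < delta)%R -> (Cmod (H u - H 0%R) <= eps)%R) ->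
  (Cmod (CI (fun u => K u * H u)%C (- / 2) (/ 2) - H 0%R) <=
    eps * M * PI + 2 * S * M * d / delta ^ 2)%R.
Proof.
intros Hd HM Hdl He CK CH HK HK1 HS Hc.
assert (HS0 : (0 <= S)%R).
{ apply Rle_trans with (1 := Cmod_ge_0 (H 0%R)). apply HS. rewrite Rabs_R0. lra. }
(* The mean 1 of [K] allows [H 0] to be moved under the integral. *)
replace (CI (fun u => K u * H u) (- / 2) (/ 2) - H 0%R)
  with (CI (fun u => K u * (H u - H 0%R)) (- / 2) (/ 2)).
2: { transitivity (CI (fun u => K u * H u) (- / 2) (/ 2) - H 0%R * CI K (- / 2) (/ 2)).
     2: { rewrite HK1. ring. }
     rewrite <- CI_scal, <- CI_minus.
     - apply CI_ext. intros; ring.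
     - intros t. apply continuous_C_mult. apply CK. apply CH.
     - intros t. apply continuous_C_mult. apply continuousC_const. apply CK.
     - exact CK. }
destruct (is_RInt_lor_scaled d Hd) as [l [Hl Il]].
apply Rle_trans with ((eps * M) * l + (/ 2 - - / 2) * (2 * S * M * d / delta ^ 2))%R.
2: { apply Rplus_le_compat. apply Rmult_le_compat_l. apply Rmult_le_pos; lra. exact Hl.
     apply Req_le. field. lra. }
(* Adding the near and the far bound gives one majorant valid on the whole interval, so the domain
   of integration is not split. *)
apply CI_le with
  (fun u => (eps * M) * (/ d * lor (/ d * u + 0)) + 2 * S * M * d / delta ^ 2)%R.
- lra.
- intros t. apply continuous_C_mult. apply CK.
  apply continuous_ext with (fun t => H t + (- H 0%R)). reflexivity.
  apply continuous_C_plus. apply CH. apply continuousC_const.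
- intros u Hu. assert (Hu' : (Rabs u <= / 2)%R) by (apply Rabs_le; lra).
  rewrite Cmod_mult. specialize (HK u Hu').
  set (L := (/ d * lor (/ d * u + 0))%R) in *.
  assert (HL : (0 < L)%R).
  { apply Rmult_lt_0_compat. apply Rinv_0_lt_compat, Hd. apply lor_pos. }
  assert (Hdl2 : (0 < delta ^ 2)%R) by nra.
  assert (T : (0 <= 2 * S * M * d / delta ^ 2)%R).
  { apply Rmult_le_pos. repeat apply Rmult_le_pos; lra.
    left; apply Rinv_0_lt_compat. exact Hdl2. }
  destruct (Rlt_dec (Rabs u) delta) as [h|h].
  + specialize (Hc u h).
    assert (Cmod (K u) * Cmod (H u - H 0%R) <= (M * L) * eps)%R.
    { apply Rmult_le_compat; try apply Cmod_ge_0; assumption. }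
    lra.
  + assert (HH : (Cmod (H u - H 0%R) <= 2 * S)%R).
    { generalize (Cmod_triangle (H u) (- H 0%R)) (HS u Hu')
        (HS 0%R ltac:(rewrite Rabs_R0; lra)). rewrite Cmod_opp. unfold Cminus. lra. }
    assert (HLd : (L <= d / delta ^ 2)%R).
    { unfold L, lor. rewrite Rplus_0_r.
      replace (/ d * / (1 + (/ d * u) ^ 2))%R with (d * / (d ^ 2 + u ^ 2))%R.
      2: { field. generalize (pow2_ge_0 u). split; apply Rgt_not_eq; nra. }
      apply Rmult_le_compat_l. lra. apply Rinv_le_contravar. exact Hdl2.
      rewrite <- (pow2_abs u). generalize (Rabs_pos u). nra. }
    assert (Cmod (K u) * Cmod (H u - H 0%R) <= (M * (d / delta ^ 2)) * (2 * S))%R.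
    { apply Rmult_le_compat; try apply Cmod_ge_0.
      apply Rle_trans with (1 := HK). apply Rmult_le_compat_l; lra. exact HH. }
    assert (0 <= eps * M * L)%R by (apply Rmult_le_pos; [apply Rmult_le_pos|]; lra).
    replace (2 * S * M * d / delta ^ 2)%R with ((M * (d / delta ^ 2)) * (2 * S))%R by (field; lra).
    lra.
- apply (is_RInt_plus (V := R_NormedModule)).
  + apply (is_RInt_scal (V := R_NormedModule)). exact Il.
  + apply (is_RInt_const (V := R_NormedModule)).
Qed.

(** * Periodization and the Poisson limit *)

Lemma locally_dominated_translates (B : R) (h : R -> C) :
  dominatedR B h -> locally_dominated 1 (fun m u => h (1 * u + IZR m)%R).
Proof.
intros Hh r. exists (B * (3 + 2 * r ^ 2))%R. intros t Ht m.
apply Rle_trans with (1 := Hh _). rewrite Rmult_assoc.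
assert (HB := dominatedR_nonneg B h Hh).
apply Rmult_le_compat_l. exact HB.
rewrite !Rmult_1_l, Rplus_comm. apply Rle_trans with (1 := lor_translate _ _).
apply Rmult_le_compat_r. left; apply lor_pos.
assert (t ^ 2 <= r ^ 2)%R; [|lra].
rewrite <- (pow2_abs t). generalize (Rabs_pos t). nra.
Qed.

(** Unit intervals centred at the integers match the symmetric partial sums: up to radius [n] they
    cover exactly [[- n - 1/2, n + 1/2]]. *)
Lemma Cintegral_unit_intervals (B : R) (f : R -> C) :
  continuousC f -> dominatedR B f ->
  Cintegral f = sumZ (fun m => CI (fun u => f (1 * u + IZR m)%R) (- / 2) (/ 2)).
Proof.
intros Cf Hf. symmetry.
destruct (locally_dominated_translates B f Hf (/ 2)%R) as [B' HB'].
apply (sumZ_unique 1 ((/ 2 - - / 2) * B')). lra.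
- apply (dominatedZ_CI 1 B' (- / 2) (/ 2) (fun m u => f (1 * u + IZR m)%R)). lra.
  intros k. apply continuous_C_comp_lin, Cf.
  intros t Ht. apply HB'. apply Rabs_le; lra.
- apply tendsC_ext with (fun n => CI f (1 * (- INR n) + - / 2) (1 * INR n + / 2)).
  2: { apply (tends_Cintegral B); try assumption.
       apply is_lim_seq_lin_m. lra. apply is_lim_seq_opp_INR.
       apply is_lim_seq_lin_p. lra. apply is_lim_seq_INR. }
  assert (E : forall m, CI (fun u => f (1 * u + IZR m)%R) (- / 2) (/ 2) =
      CI f (IZR m - / 2) (IZR m + / 2)).
  { intros m. transitivity (RtoC 1 * CI (fun u => f (1 * u + IZR m)%R) (- / 2) (/ 2)). ring.
    rewrite <- CI_comp_lin by exact Cf. f_equal; ring. }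
  intros n. rewrite !Rmult_1_l. induction n as [|n IH]; cbn [symsum].
  + rewrite E. f_equal; simpl; ring.
  + rewrite <- IH, !E, opp_IZR, <- INR_IZR_INZ.
    replace (INR (S n) - / 2)%R with (INR n + / 2)%R by (rewrite S_INR; field).
    replace (- INR (S n) + / 2)%R with (- INR n + - / 2)%R by (rewrite S_INR; field).
    rewrite (CI_Chasles f _ (- INR n + - / 2) _ Cf).
    rewrite (CI_Chasles f (- INR n + - / 2) (INR n + / 2) _ Cf).
    replace (- INR (S n) - / 2)%R with (- INR (S n) + - / 2)%R by ring. ring.
Qed.

Definition periodization (h : R -> C) (u : R) : C := sumZ (fun m => h (1 * u + IZR m)%R).

Lemma periodization_continuousC (B : R) (h : R -> C) :
  continuousC h -> dominatedR B h -> continuousC (periodization h).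
Proof.
intros Ch Hh. apply (sumZ_continuousC 1 (fun m u => h (1 * u + IZR m)%R)). lra.
intros k. apply continuous_C_comp_lin, Ch. apply (locally_dominated_translates B), Hh.
Qed.

Lemma periodization_bound (B : R) (h : R -> C) (r : R) :
  dominatedR B h -> exists S, forall u, (Rabs u <= r)%R -> (Cmod (periodization h u) <= S)%R.
Proof.
intros Hh. destruct (locally_dominated_translates B h Hh r) as [B' HB'].
exists (B' * (1 + PI / 1))%R. intros u Hu. apply sumZ_bound. lra. apply HB', Hu.
Qed.

(** Unfolding: cut the line into unit intervals, bring each back to the period, where [wave k] is
    unchanged, and exchange sum and integral. *)
Lemma fourier_coefficient_periodization (B : R) (h : R -> C) (k : Z) :
  continuousC h -> dominatedR B h ->
  Cintegral (fun u => wave k u * h u) =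
  CI (fun u => wave k u * periodization h u) (- / 2) (/ 2).
Proof.
intros Ch Hh.
assert (Cw : continuousC (fun u => wave k u * h u)).
{ intros t. apply continuous_C_mult. apply wave_continuousC. apply Ch. }
assert (Hw : dominatedR (1 * B) (fun u => wave k u * h u)).
{ apply dominatedR_mult. intros t. rewrite Cmod_wave. lra. exact Hh. }
rewrite (Cintegral_unit_intervals _ _ Cw Hw).
set (f := fun (m : Z) (u : R) => wave k u * h (1 * u + IZR m)%R).
transitivity (sumZ (fun m => CI (f m) (- / 2) (/ 2))).
{ apply sumZ_ext. intros m. apply CI_ext. intros u. unfold f. rewrite wave_period. reflexivity. }
rewrite <- (CI_sumZ 1); try lra.
- apply CI_ext. intros u. unfold f, periodization.
  destruct (locally_dominated_translates B h Hh (Rabs u)) as [B' HB'].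
  apply (sumZ_scal 1 B'). lra. apply HB'. lra.
- intros m t. apply continuous_C_mult. apply wave_continuousC.
  apply continuous_C_comp_lin, Ch.
- intros r. destruct (locally_dominated_translates B h Hh r) as [B' HB'].
  exists (1 * B')%R. intros t Ht. apply (dominatedZ_mult 1 B' 1 (fun _ => wave k t)).
  intros _. rewrite Cmod_wave. lra. apply HB', Ht.
Qed.

Lemma kernel_continuousC (d B : R) (c : Z -> C) :
  (0 < d)%R -> dominatedZ d B c -> continuousC (kernel c).
Proof.
intros Hd H. apply (sumZ_continuousC d (fun k u => c k * wave k u) Hd).
- intros k t. apply continuous_C_mult. apply continuousC_const. apply wave_continuousC.
- intros r. exists B. intros t _. apply dominatedZ_wave, H.
Qed.

Lemma CI_kernel (d B : R) (c : Z -> C) :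
  (0 < d)%R -> dominatedZ d B c -> CI (kernel c) (- / 2) (/ 2) = c 0%Z.
Proof.
intros Hd H. unfold kernel.
rewrite (CI_sumZ d _ _ (fun k u => c k * wave k u) Hd); try lra.
- assert (E : forall k, CI (fun u => c k * wave k u) (- / 2) (/ 2) =
    c k * CI (wave k) (- / 2) (/ 2)).
  { intros k. apply CI_scal. apply wave_continuousC. }
  rewrite sumZ_single.
  + rewrite E, CI_wave_0. ring.
  + intros k Hk. rewrite E, CI_wave by exact Hk. ring.
- intros k t. apply continuous_C_mult. apply continuousC_const. apply wave_continuousC.
- intros r. exists B. intros t _. apply dominatedZ_wave, H.
Qed.

(** The decay of the weights [c] alone makes the series in [k] absolutely convergent, uniformly in
    [u], so it can be summed under the integral. *)
Lemma sumZ_fourier_coefficients (d B Bh : R) (c : Z -> C) (h : R -> C) :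
  (0 < d)%R -> dominatedZ d B c -> continuousC h -> dominatedR Bh h ->
  sumZ (fun k => c k * Cintegral (fun u => wave k u * h u)) =
  CI (fun u => kernel c u * periodization h u) (- / 2) (/ 2).
Proof.
intros Hd H Ch Hh.
assert (CP := periodization_continuousC Bh h Ch Hh).
set (f := fun (k : Z) (u : R) => periodization h u * (c k * wave k u)).
transitivity (sumZ (fun k => CI (f k) (- / 2) (/ 2))).
{ apply sumZ_ext. intros k.
  rewrite (fourier_coefficient_periodization Bh h k Ch Hh), <- CI_scal.
  - apply CI_ext. intros u. unfold f. ring.
  - intros t. apply continuous_C_mult. apply wave_continuousC. apply CP. }
rewrite <- (CI_sumZ d); try lra.
- apply CI_ext. intros u. unfold f. rewrite (sumZ_scal d B). unfold kernel. ring.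
  exact Hd. apply dominatedZ_wave, H.
- intros k t. apply continuous_C_mult. apply CP.
  apply continuous_C_mult. apply continuousC_const. apply wave_continuousC.
- intros r. destruct (periodization_bound Bh h r Hh) as [S HS].
  exists (S * B)%R. intros t Ht.
  apply (dominatedZ_mult d B S (fun _ => periodization h t)).
  intros _. apply HS, Ht. apply dominatedZ_wave, H.
Qed.

(** Of [eta] only its decay, its value at 0 and its second differences at steps up to [a] enter. At
    stage [n] the weights sample [eta] with step [d = a / INR (S n)], so the kernel concentrates at
    0, where the periodization of [h] is the sum of the values at the integers. *)
Lemma poisson_summability (a B B2 Bh : R) (eta h : R -> C) :
  (0 < a)%R -> dominatedR B eta ->
  (forall y e, (0 < e <= a)%R ->
     (Cmod (eta (y - e)%R - 2 * eta y + eta (y + e)%R) <= B2 * e ^ 2 * lor y)%R) ->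
  eta 0%R = 1 -> continuousC h -> dominatedR Bh h ->
  tendsC (fun n => sumZ (fun k => eta (IZR k * a / INR (S n))%R *
                                  Cintegral (fun u => wave k u * h u)))
         (sumZ (fun m => h (IZR m))).
Proof.
intros Ha He He2 He0 Ch Hh.
assert (HB := dominatedR_nonneg _ _ He).
assert (HB2 : (0 <= B2)%R).
{ generalize (He2 0%R a ltac:(lra)) (Cmod_ge_0 (eta (0 - a)%R - 2 * eta 0%R + eta (0 + a)%R)).
  rewrite lor_0. intros. apply Rmult_le_reg_r with (a ^ 2)%R; nra. }
assert (HPI := PI_RGT_0).
assert (CP := periodization_continuousC Bh h Ch Hh).
destruct (periodization_bound Bh h (/ 2) Hh) as [S HS].
assert (HS0 : (0 <= S)%R).
{ apply Rle_trans with (1 := Cmod_ge_0 (periodization h 0%R)). apply HS. rewrite Rabs_R0. lra. }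
replace (sumZ (fun m => h (IZR m))) with (periodization h 0%R).
2: { apply sumZ_ext. intros m. f_equal. ring. }
set (M := ((B + B2) * (a + PI))%R).
assert (HM : (0 <= M)%R) by (apply Rmult_le_pos; lra).
intros eps Heps.
(* Chosen so that the near error [e1 * M * PI] is below [eps / 2]; the added 1 covers [M = 0]. *)
set (e1 := (eps / (2 * (M * PI + 1)))%R).
assert (HMP : (0 <= M * PI)%R) by (apply Rmult_le_pos; lra).
assert (He1 : (0 < e1)%R) by (apply Rdiv_lt_0_compat; lra).
assert (He1' : (e1 * M * PI < eps / 2)%R).
{ unfold e1. apply Rmult_lt_reg_r with (2 * (M * PI + 1))%R. lra.
  replace (eps / (2 * (M * PI + 1)) * M * PI * (2 * (M * PI + 1)))%R with (eps * (M * PI))%R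
    by (field; lra).
  nra. }
destruct (proj1 (continuous_C_eps _ 0) (CP 0%R) e1 He1) as [dl [Hdl Hc]].
(* The far error of [approximate_identity] at [d = a / INR (S n)] is [Q] divided by [n + 1]; here
   [S] names the bound on the periodization. *)
set (Q := (2 * S * M * a / dl ^ 2)%R).
assert (HQ : (0 <= Q)%R).
{ apply Rmult_le_pos. repeat apply Rmult_le_pos; lra. left; apply Rinv_0_lt_compat. nra. }
assert (LQ : is_lim_seq INR p_infty) by apply is_lim_seq_INR.
apply is_lim_seq_spec in LQ. destruct (LQ (Q / (eps / 2))%R) as [n0 Hn0].
exists n0. intros n Hn.
assert (HSn : (0 < INR (Datatypes.S n))%R) by (apply lt_0_INR; lia).
assert (HSn1 : (1 <= INR (Datatypes.S n))%R) by (rewrite S_INR; generalize (pos_INR n); lra).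
set (d := (a / INR (Datatypes.S n))%R).
assert (Hd : (0 < d)%R) by (apply Rdiv_lt_0_compat; lra).
assert (Hda : (d <= a)%R).
{ unfold d. apply Rmult_le_reg_r with (INR (Datatypes.S n)). lra.
  unfold Rdiv. rewrite Rmult_assoc, Rinv_l by lra. nra. }
set (c := fun k : Z => eta (IZR k * a / INR (Datatypes.S n))%R).
assert (Ek : forall k, (IZR k * a / INR (Datatypes.S n) = d * IZR k)%R).
{ intros k. unfold d. field. lra. }
assert (Hc1 : dominatedZ d B c).
{ intros k. unfold c. rewrite Ek. apply He. }
assert (Hc2 : dominatedZ d (B2 * d ^ 2) (diff2 c)).
{ intros k. unfold diff2, c. rewrite !Ek, minus_IZR, plus_IZR.
  replace (d * (IZR k - 1))%R with (d * IZR k - d)%R by ring.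
  replace (d * (IZR k + 1))%R with (d * IZR k + d)%R by ring.
  apply He2. lra. }
change (sumZ _) with (sumZ (fun k => c k * Cintegral (fun u => wave k u * h u))).
rewrite (sumZ_fourier_coefficients d B Bh c h Hd Hc1 Ch Hh).
eapply Rle_lt_trans.
- apply (approximate_identity d M S e1 dl); try assumption; try lra.
  + apply (kernel_continuousC d B); assumption.
  + intros u Hu. apply (kernel_le a d B B2); assumption.
  + rewrite (CI_kernel d B c Hd Hc1). unfold c. rewrite <- He0. f_equal. field. lra.
  + intros u Hu. left. apply Hc. rewrite Rminus_0_r. exact Hu.
- assert (2 * S * M * d / dl ^ 2 < eps / 2)%R; [|lra].
  replace (2 * S * M * d / dl ^ 2)%R with (Q / INR (Datatypes.S n))%R
    by (unfold Q, d; field; split; lra).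
  specialize (Hn0 n Hn).
  apply Rmult_lt_reg_r with (INR (Datatypes.S n)). exact HSn.
  unfold Rdiv at 1. rewrite Rmult_assoc, Rinv_l, Rmult_1_r by lra.
  apply Rmult_lt_compat_l with (r := (eps / 2)%R) in Hn0; [|lra].
  replace (eps / 2 * (Q / (eps / 2)))%R with Q in Hn0 by (field; lra).
  rewrite S_INR. lra.
Qed.

(** * Schwartz functions and their Fourier transforms *)

Definition Cderiv (phi : R -> C) : R -> C := CDerive_n phi 1.

Lemma ex_derive_n_Derive (f : R -> R) (n : nat) (t : R) :
  (forall m t, ex_derive_n f m t) -> ex_derive_n (Derive f) n t.
Proof.
intros H. destruct n as [|n]; [exact I|]. simpl.
apply ex_derive_ext with (Derive_n f (S n)).
- intros s. rewrite <- (Nat.add_1_r n). symmetry. apply (Derive_n_comp f n 1).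
- apply (H (S (S n)) t).
Qed.

Lemma CDerive_n_Cderiv (phi : R -> C) (n : nat) (t : R) :
  CDerive_n (Cderiv phi) n t = CDerive_n phi (S n) t.
Proof.
unfold CDerive_n. rewrite <- (Nat.add_1_r n), <- !(Derive_n_comp _ n 1). reflexivity.
Qed.

Lemma schwartz_Cderiv (phi : R -> C) : schwartz phi -> schwartz (Cderiv phi).
Proof.
intros [H1 H2]. split.
- intros n t. split.
  + apply (ex_derive_n_Derive (CRe phi)). intros; apply H1.
  + apply (ex_derive_n_Derive (CIm phi)). intros; apply H1.
- intros m n. destruct (H2 m (S n)) as [B HB]. exists B. intros t.
  rewrite CDerive_n_Cderiv. apply HB.
Qed.

Lemma schwartz_continuousC (phi : R -> C) : schwartz phi -> continuousC phi.
Proof.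
intros [H _] t. apply continuous_C_pair.
destruct (H 1%nat t) as [H1 H2]. split.
- apply (ex_derive_continuous (V := R_NormedModule) (CRe phi)). exact H1.
- apply (ex_derive_continuous (V := R_NormedModule) (CIm phi)). exact H2.
Qed.

Lemma Cmod_le_Re_Im (z : C) : (Cmod z <= Rabs (Re z) + Rabs (Im z))%R.
Proof.
replace z with (RtoC (Re z) + Ci * RtoC (Im z)) at 1.
- eapply Rle_trans. apply Cmod_triangle. rewrite Cmod_mult, Cmod_Ci, !Cmod_R. lra.
- destruct z. apply injective_projections; simpl; ring.
Qed.

Lemma CDerive_n_0 (phi : R -> C) (t : R) : CDerive_n phi 0 t = phi t.
Proof. unfold CDerive_n, CRe, CIm. simpl. symmetry. apply surjective_pairing. Qed.

Lemma dominatedR_of_moments (B : R) (f : R -> C) :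
  (forall i t, (i <= 2)%nat -> (Rabs t ^ i * Cmod (f t) <= B)%R) -> dominatedR (2 * B) f.
Proof.
intros H t. apply le_lor. generalize (H 0%nat t ltac:(lia)) (H 2%nat t ltac:(lia)).
rewrite pow2_abs, pow_O. lra.
Qed.

(** Moments and derivatives are counted separately because the Fourier transform treats them
    differently: derivatives of [phi] become decay, while two moments are spent on integrability. *)
Definition seminorms_le (m n : nat) (phi : R -> C) (B : R) : Prop :=
  forall (i j : nat) (t : R), (i <= m)%nat -> (j <= n)%nat ->
    (Rabs t ^ i * Cmod (CDerive_n phi j t) <= B)%R.

(** [schwartz] gives one bound for each pair of orders; two nested inductions take the maximum over
    finitely many pairs. *)
Lemma schwartz_seminorms (phi : R -> C) (m n : nat) :
  schwartz phi -> exists B, seminorms_le m n phi B.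
Proof.
intros [_ H].
assert (K : forall i, exists B, forall j t, (j <= n)%nat ->
  (Rabs t ^ i * Cmod (CDerive_n phi j t) <= B)%R).
{ intros i. induction n as [|n [B HB]].
  - destruct (H i 0%nat) as [B HB]. exists B. intros j t Hj.
    replace j with 0%nat by lia. apply HB.
  - destruct (H i (S n)) as [B' HB']. exists (Rmax B B'). intros j t Hj.
    destruct (Nat.eq_dec j (S n)) as [->|Hne].
    + apply Rle_trans with (2 := Rmax_r _ _). apply HB'.
    + apply Rle_trans with (2 := Rmax_l _ _). apply HB. lia. }
clear H. unfold seminorms_le. induction m as [|m [B HB]].
- destruct (K 0%nat) as [B HB]. exists B. intros i j t Hi Hj.
  replace i with 0%nat by lia. apply HB, Hj.
- destruct (K (S m)) as [B' HB']. exists (Rmax B B'). intros i j t Hi Hj.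
  destruct (Nat.eq_dec i (S m)) as [->|Hne].
  + apply Rle_trans with (2 := Rmax_r _ _). apply HB', Hj.
  + apply Rle_trans with (2 := Rmax_l _ _). apply HB; lia.
Qed.

Lemma seminorms_dominatedR (n j : nat) (phi : R -> C) (B : R) :
  seminorms_le 2 n phi B -> (j <= n)%nat -> dominatedR (2 * B) (CDerive_n phi j).
Proof. intros H Hj. apply dominatedR_of_moments. intros i t Hi. apply H; assumption. Qed.

Lemma seminorms_dominatedR_0 (n : nat) (phi : R -> C) (B : R) :
  seminorms_le 2 n phi B -> dominatedR (2 * B) phi.
Proof.
intros H t. rewrite <- (CDerive_n_0 phi t). apply (seminorms_dominatedR n 0 phi B H). lia.
Qed.

Lemma schwartz_dominatedR (phi : R -> C) : schwartz phi -> exists B, dominatedR B phi.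
Proof.
intros H. destruct (schwartz_seminorms phi 2 0 H) as [B HB].
exists (2 * B)%R. apply (seminorms_dominatedR_0 0), HB.
Qed.

(** The mean value theorem, applied to [z |-> f (z + e) - f z] on [[y - e, y]] and next to the
    derivative of [f], writes the second difference as [e ^ 2] times the second derivative at a
    point [z] within [a] of [y]; [lor_translate] moves the bound from [z] to [y] at the cost of
    [3 + 2 * a ^ 2]. *)
Lemma second_difference_le (f : R -> R) (B a y e : R) :
  (forall n t, ex_derive_n f n t) ->
  (forall t, (Rabs (Derive_n f 2 t) <= B * lor t)%R) ->
  (0 < e <= a)%R ->
  (Rabs (f (y - e) - 2 * f y + f (y + e)) <= B * (3 + 2 * a ^ 2) * e ^ 2 * lor y)%R.
Proof.
intros Hex HB He.
assert (D1 : forall t, is_derive f t (Derive f t)).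
{ intros t. apply Derive_correct. apply (Hex 1%nat t). }
assert (D2 : forall t, is_derive (Derive f) t (Derive_n f 2 t)).
{ intros t. apply Derive_correct. apply (Hex 2%nat t). }
assert (HB0 : (0 <= B)%R).
{ generalize (HB 0%R) (Rabs_pos (Derive_n f 2 0)). rewrite lor_0. lra. }
assert (C : forall (g dg : R -> R), (forall t, is_derive g t (dg t)) -> forall t, continuity_pt g t).
{ intros g dg Hg t. apply continuity_pt_filterlim.
  apply (ex_derive_continuous (V := R_NormedModule) g). exists (dg t). apply Hg. }
set (G := fun z => (f (z + e) - f z)%R).
assert (DG : forall t, is_derive G t (Derive f (t + e) - Derive f t)%R).
{ intros t. unfold G. auto_derive.
  - repeat split; try (eexists; apply D1).
  - rewrite !Rmult_1_l. reflexivity. }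
destruct (MVT_gen G (y - e) y (fun t => Derive f (t + e) - Derive f t)%R) as [x [Hx Ex]].
{ intros; apply DG. } { intros; eapply C, DG. }
destruct (MVT_gen (Derive f) x (x + e) (Derive_n f 2)) as [z [Hz Ez]].
{ intros; apply D2. } { intros; eapply C, D2. }
rewrite Rmin_left, Rmax_right in Hx by lra. rewrite Rmin_left, Rmax_right in Hz by lra.
assert (E : (f (y - e) - 2 * f y + f (y + e) = Derive_n f 2 z * e ^ 2)%R).
{ transitivity (G y - G (y - e))%R.
  unfold G. replace (y - e + e)%R with y by ring. ring.
  rewrite Ex, Ez. ring. }
rewrite E, Rabs_mult, (Rabs_pos_eq (e ^ 2)) by apply pow2_ge_0.
replace (B * (3 + 2 * a ^ 2) * e ^ 2 * lor y)%R with ((B * ((3 + 2 * a ^ 2) * lor y)) * e ^ 2)%R by ring.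
apply Rmult_le_compat_r. apply pow2_ge_0.
apply Rle_trans with (1 := HB z). apply Rmult_le_compat_l. exact HB0.
replace z with (y + (z - y))%R by ring.
apply Rle_trans with (1 := lor_translate _ _).
apply Rmult_le_compat_r. left; apply lor_pos.
assert ((z - y) ^ 2 <= a ^ 2)%R; [|lra].
rewrite <- (pow2_abs (z - y)). assert (Rabs (z - y) <= a)%R by (apply Rabs_le; lra).
generalize (Rabs_pos (z - y)). nra.
Qed.

Lemma schwartz_second_difference (eta : R -> C) (a : R) :
  schwartz eta -> exists B, forall y e, (0 < e <= a)%R ->
  (Cmod (eta (y - e)%R - 2 * eta y + eta (y + e)%R) <= B * e ^ 2 * lor y)%R.
Proof.
intros H. destruct (schwartz_seminorms eta 2 2 H) as [B HB].
assert (D := seminorms_dominatedR 2 2 eta B HB (le_n _)).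
exists (2 * (2 * B * (3 + 2 * a ^ 2)))%R. intros y e He.
apply Rle_trans with (1 := Cmod_le_Re_Im _).
assert (K1 := second_difference_le (CRe eta) (2 * B) a y e
   (fun n t => proj1 (proj1 H n t))
   (fun t => Rle_trans _ _ _ (re_le_Cmod (CDerive_n eta 2 t)) (D t)) He).
assert (K2 := second_difference_le (CIm eta) (2 * B) a y e
   (fun n t => proj2 (proj1 H n t))
   (fun t => Rle_trans _ _ _ (Im_le_Cmod (CDerive_n eta 2 t)) (D t)) He).
replace (Re (eta (y - e)%R - 2 * eta y + eta (y + e)%R))
  with (CRe eta (y - e) - 2 * CRe eta y + CRe eta (y + e))%R.
2: { unfold CRe, Re. simpl. ring. }
replace (Im (eta (y - e)%R - 2 * eta y + eta (y + e)%R))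
  with (CIm eta (y - e) - 2 * CIm eta y + CIm eta (y + e))%R.
2: { unfold CIm, Im. simpl. ring. }
lra.
Qed.

(** * Decay and continuity of Fourier transforms *)

Lemma cis_opp_lin_continuousC (f : R) : continuousC (fun t => cis (- (2 * PI * f * t))).
Proof.
intros t. apply (continuous_ext (fun t => cis (- (2 * PI * f) * t + 0))).
intros s. f_equal. ring. apply continuousC_cis.
Qed.

Lemma fourier_integrand_continuousC (phi : R -> C) (f : R) :
  continuousC phi -> continuousC (fun t => phi t * cis (- (2 * PI * f * t))).
Proof. intros H t. apply continuous_C_mult. apply H. apply cis_opp_lin_continuousC. Qed.

Lemma fourier_integrand_dominatedR (B : R) (phi : R -> C) (f : R) :
  dominatedR B phi -> dominatedR B (fun t => phi t * cis (- (2 * PI * f * t))).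
Proof. intros H t. rewrite Cmod_mult, Cmod_cis, Rmult_1_r. apply H. Qed.

Lemma fourier_bound (B : R) (phi : R -> C) (f : R) :
  continuousC phi -> dominatedR B phi -> (Cmod (fourier phi f) <= B * PI)%R.
Proof.
intros Hc Hd. apply Cintegral_bound. apply fourier_integrand_continuousC, Hc.
apply fourier_integrand_dominatedR, Hd.
Qed.

Lemma fourier_linear (B B' : R) (a : C) (phi psi : R -> C) (f : R) :
  continuousC phi -> continuousC psi -> dominatedR B phi -> dominatedR B' psi ->
  fourier (fun t => a * phi t + psi t) f = a * fourier phi f + fourier psi f.
Proof.
intros C1 C2 H1 H2. unfold fourier.
assert (C1' := fourier_integrand_continuousC phi f C1).
assert (C2' := fourier_integrand_continuousC psi f C2).
assert (H1' := fourier_integrand_dominatedR B phi f H1).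
assert (H2' := fourier_integrand_dominatedR B' psi f H2).
rewrite <- (Cintegral_scal B a _ C1' H1').
rewrite <- (Cintegral_plus (Cmod a * B) B'); try assumption.
- apply Cintegral_ext. intros t. ring.
- intros t. apply continuous_C_mult. apply continuousC_const. apply C1'.
- apply (dominatedR_mult B (Cmod a) (fun _ => a)). intros; lra. exact H1'.
Qed.

Lemma fourier_shift (B s : R) (phi : R -> C) (t : R) :
  continuousC phi -> dominatedR B phi ->
  fourier (fun f => phi (f + s)%R) t = cis (2 * PI * t * s) * fourier phi t.
Proof.
intros Hc Hd. unfold fourier.
set (G := fun f => phi f * cis (- (2 * PI * t * f))).
assert (CG : continuousC G) by apply fourier_integrand_continuousC, Hc.
assert (DG : dominatedR B G) by apply fourier_integrand_dominatedR, Hd.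
rewrite <- (Cintegral_comp_lin B 1 s G Rlt_0_1 CG DG).
replace (cis (2 * PI * t * s) * (1 * Cintegral (fun t => G (1 * t + s)%R)))
  with (cis (2 * PI * t * s) * Cintegral (fun t => G (1 * t + s)%R)) by ring.
rewrite <- (Cintegral_scal _ (cis (2 * PI * t * s)) _ (continuous_C_comp_lin G 1 s CG)
   (dominatedR_comp_lin B 1 s G Rlt_0_1 DG)).
apply Cintegral_ext. intros f. unfold G.
replace (- (2 * PI * t * f))%R with (2 * PI * t * s + - (2 * PI * t * (1 * f + s)))%R at 1 by ring.
rewrite cis_add, Rmult_1_l. ring.
Qed.

(** The integrand is the derivative of [phi t * cis (- (w * t))]; the fundamental theorem of
    calculus is applied to its real and imaginary parts. *)
Lemma CI_derivative_twisted (phi : R -> C) (w a b : R) :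
  schwartz phi ->
  CI (fun t => Cderiv phi t * cis (- (w * t)) + - (Ci * RtoC w) * (phi t * cis (- (w * t)))) a b =
  phi b * cis (- (w * b)) - phi a * cis (- (w * a)).
Proof.
intros H. apply CI_unique.
assert (H' := schwartz_continuousC _ (schwartz_Cderiv _ H)).
assert (H0 := schwartz_continuousC _ H).
assert (DR : forall t, is_derive (CRe phi) t (Derive (CRe phi) t)).
{ intros t. apply Derive_correct. apply (proj1 (proj1 H 1%nat t)). }
assert (DI : forall t, is_derive (CIm phi) t (Derive (CIm phi) t)).
{ intros t. apply Derive_correct. apply (proj2 (proj1 H 1%nat t)). }
assert (CE : continuousC (fun t => cis (- (w * t)))).
{ intros t. apply (continuous_ext (fun t => cis (- w * t + 0))).
  intros s. f_equal. ring. apply continuousC_cis. }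
set (F := fun t => Cderiv phi t * cis (- (w * t)) + - (Ci * RtoC w) * (phi t * cis (- (w * t)))).
assert (CF : continuousC F).
{ intros t. apply continuous_C_plus. apply continuous_C_mult. apply H'. apply CE.
  apply continuous_C_mult. apply continuousC_const. apply continuous_C_mult. apply H0. apply CE. }
set (P := fun t => phi t * cis (- (w * t))).
assert (ER : fst (P b - P a) = minus (Re (P b)) (Re (P a))) by reflexivity.
assert (EI : snd (P b - P a) = minus (Im (P b)) (Im (P a))) by reflexivity.
change (phi b * cis (- (w * b)) - phi a * cis (- (w * a))) with (P b - P a).
rewrite (surjective_pairing (P b - P a)), ER, EI.
apply (is_RInt_fct_extend_pair (U := R_NormedModule) (V := R_NormedModule)).
- apply (is_RInt_derive (V := R_CompleteNormedModule) (fun t => Re (P t)) (fun t => Re (F t))).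
  + intros t _.
    apply (is_derive_ext (fun t => CRe phi t * cos (- (w * t)) - CIm phi t * sin (- (w * t)))%R).
    reflexivity.
    auto_derive.
    * repeat split. exists (Derive (CRe phi) t); apply DR. exists (Derive (CIm phi) t); apply DI.
    * unfold F, Cderiv, CDerive_n, cis, Re. simpl. unfold CRe, CIm, Re, Im.
      change (Derive_n (fun t => fst (phi t)) 1 t) with (Derive (fun t => fst (phi t)) t).
      change (Derive_n (fun t => snd (phi t)) 1 t) with (Derive (fun t => snd (phi t)) t). ring.
  + intros t _. apply (proj1 (proj1 (continuous_C_pair F t) (CF t))).
- apply (is_RInt_derive (V := R_CompleteNormedModule) (fun t => Im (P t)) (fun t => Im (F t))).
  + intros t _.
    apply (is_derive_ext (fun t => CRe phi t * sin (- (w * t)) + CIm phi t * cos (- (w * t)))%R).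
    reflexivity.
    auto_derive.
    * repeat split. exists (Derive (CRe phi) t); apply DR. exists (Derive (CIm phi) t); apply DI.
    * unfold F, Cderiv, CDerive_n, cis, Im. simpl. unfold CRe, CIm, Re, Im.
      change (Derive_n (fun t => fst (phi t)) 1 t) with (Derive (fun t => fst (phi t)) t).
      change (Derive_n (fun t => snd (phi t)) 1 t) with (Derive (fun t => snd (phi t)) t). ring.
  + intros t _. apply (proj2 (proj1 (continuous_C_pair F t) (CF t))).
Qed.

Lemma fourier_Cderiv (phi : R -> C) (f : R) :
  schwartz phi -> fourier (Cderiv phi) f = Ci * RtoC (2 * PI * f) * fourier phi f.
Proof.
intros H. set (w := (2 * PI * f)%R).
destruct (schwartz_dominatedR phi H) as [B HB].
destruct (schwartz_dominatedR _ (schwartz_Cderiv phi H)) as [B' HB'].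
assert (C0 := fourier_integrand_continuousC phi f (schwartz_continuousC _ H)).
assert (C1 := fourier_integrand_continuousC _ f (schwartz_continuousC _ (schwartz_Cderiv _ H))).
assert (D0 := fourier_integrand_dominatedR B phi f HB).
assert (D1 := fourier_integrand_dominatedR B' _ f HB').
fold w in C0, C1, D0, D1.
set (c := - (Ci * RtoC w)).
assert (C0' : continuousC (fun t => c * (phi t * cis (- (w * t))))).
{ intros t. apply continuous_C_mult. apply continuousC_const. apply C0. }
assert (D0' : dominatedR (Cmod c * B) (fun t => c * (phi t * cis (- (w * t))))).
{ apply (dominatedR_mult B (Cmod c) (fun _ => c)). intros; lra. exact D0. }
assert (E : Cintegral (fun t => Cderiv phi t * cis (- (w * t)) + c * (phi t * cis (- (w * t)))) = 0).
{ apply (Cintegral_unique (B' + Cmod c * B) _ (fun n => - INR n)%R INR).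
  - intros t. apply continuous_C_plus. apply C1. apply C0'.
  - apply dominatedR_plus; assumption.
  - apply is_lim_seq_opp_INR.
  - apply is_lim_seq_INR.
  (* The truncated integral is a difference of boundary values at [n] and [- n], each of modulus at
     most [B * lor n]. *)
  - apply tendsC_0_bound with (fun n => 2 * B * lor (1 * INR n))%R.
    + intros n. unfold c. rewrite (CI_derivative_twisted phi w _ _ H).
      generalize (Cmod_triangle (phi (INR n) * cis (- (w * INR n)))
        (- (phi (- INR n)%R * cis (- (w * - INR n))))).
      rewrite Cmod_opp, !Cmod_mult, !Cmod_cis.
      generalize (HB (INR n)) (HB (- INR n)%R). rewrite lor_opp, Rmult_1_l. unfold Cminus. lra.
    + replace (Finite 0) with (Rbar_mult (2 * B)%R 0) by (simpl; f_equal; ring).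
      apply is_lim_seq_scal_l, lor_INR_lim. lra. }
rewrite (Cintegral_plus B' (Cmod c * B) _ _ C1 C0' D1 D0'),
  (Cintegral_scal B c _ C0 D0) in E.
change (Cintegral (fun t => Cderiv phi t * cis (- (w * t)))) with (fourier (Cderiv phi) f) in E.
change (Cintegral (fun t => phi t * cis (- (w * t)))) with (fourier phi f) in E.
replace (fourier (Cderiv phi) f)
  with ((fourier (Cderiv phi) f + c * fourier phi f) + Ci * RtoC w * fourier phi f).
rewrite E. ring. unfold c. ring.
Qed.

(** Each factor of [f] is traded for a derivative of [phi] by [fourier_Cderiv]; the two moments make
    the last derivative integrable. The factors [2 * PI >= 1] gained on the way are dropped. *)
Lemma fourier_moment (M : nat) (phi : R -> C) (B f : R) :
  schwartz phi -> seminorms_le 2 M phi B ->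
  (Rabs f ^ M * Cmod (fourier phi f) <= 2 * B * PI)%R.
Proof.
revert phi. induction M as [|M IH]; intros phi H HB.
- rewrite pow_O, Rmult_1_l. apply fourier_bound. apply schwartz_continuousC, H.
  apply (seminorms_dominatedR_0 0), HB.
- assert (HB' : seminorms_le 2 M (Cderiv phi) B).
  { intros i j t Hi Hj. rewrite CDerive_n_Cderiv. apply HB; lia. }
  specialize (IH _ (schwartz_Cderiv phi H) HB').
  rewrite fourier_Cderiv, !Cmod_mult, Cmod_Ci, Cmod_R in IH by exact H.
  rewrite Rabs_mult, (Rabs_pos_eq (2 * PI)) in IH by (generalize PI_RGT_0; lra).
  apply Rle_trans with (2 := IH). simpl.
  assert (HP : (1 <= 2 * PI)%R) by (generalize PI2_3_2; lra).
  assert (Q : (0 <= Rabs f * Rabs f ^ M * Cmod (fourier phi f))%R).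
  { apply Rmult_le_pos; [|apply Cmod_ge_0]. apply Rmult_le_pos. apply Rabs_pos.
    apply pow_le, Rabs_pos. }
  nra.
Qed.

Definition decays (M : nat) (B : R) (psi : R -> C) : Prop :=
  forall t, ((1 + Rabs t) ^ M * Cmod (psi t) <= B)%R.

Lemma pow_1_plus_le (M : nat) (s : R) : (0 <= s)%R -> ((1 + s) ^ M <= 2 ^ M * (1 + s ^ M))%R.
Proof.
intros Hs. assert (H2 : (0 <= 2 ^ M)%R) by (apply pow_le; lra).
destruct (Rle_dec s 1) as [h|h].
- apply Rle_trans with (2 ^ M * 1)%R.
  + rewrite Rmult_1_r. apply pow_incr. lra.
  + apply Rmult_le_compat_l. exact H2. generalize (pow_le s M Hs). lra.
- apply Rle_trans with (2 ^ M * s ^ M)%R.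
  + rewrite <- Rpow_mult_distr. apply pow_incr. lra.
  + apply Rmult_le_compat_l. exact H2. lra.
Qed.

Lemma decays_of_moments (M : nat) (B : R) (psi : R -> C) :
  (forall t, (Cmod (psi t) <= B)%R) -> (forall t, (Rabs t ^ M * Cmod (psi t) <= B)%R) ->
  decays M (2 ^ M * (2 * B)) psi.
Proof.
intros H0 HM t.
apply Rle_trans with (2 ^ M * (1 + Rabs t ^ M) * Cmod (psi t))%R.
- apply Rmult_le_compat_r. apply Cmod_ge_0. apply pow_1_plus_le, Rabs_pos.
- rewrite Rmult_assoc. apply Rmult_le_compat_l. apply pow_le; lra.
  generalize (H0 t) (HM t). lra.
Qed.

Lemma fourier_decays (M : nat) (phi : R -> C) (B : R) :
  schwartz phi -> seminorms_le 2 M phi B ->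
  decays M (2 ^ M * (2 * (2 * B * PI))) (fourier phi).
Proof.
intros H HB. apply decays_of_moments; intros t.
- replace (Cmod (fourier phi t)) with (Rabs t ^ 0 * Cmod (fourier phi t))%R by (simpl; ring).
  apply fourier_moment. exact H. intros i j s Hi Hj. apply HB; lia.
- apply fourier_moment; assumption.
Qed.

Lemma schwartz_decays (M : nat) (phi : R -> C) (B : R) :
  seminorms_le M 0 phi B -> decays M (2 ^ M * (2 * B)) phi.
Proof.
intros HB. apply decays_of_moments; intros t; rewrite <- (CDerive_n_0 phi t).
- generalize (HB 0%nat 0%nat t ltac:(lia) ltac:(lia)). simpl. lra.
- apply HB; lia.
Qed.

Lemma lipschitz_of_derive_le_1 (f df : R -> R) (a b : R) :
  (forall t, is_derive f t (df t)) -> (forall t, (Rabs (df t) <= 1)%R) ->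
  (Rabs (f b - f a) <= Rabs (b - a))%R.
Proof.
intros H H1. destruct (MVT_gen f a b df) as [c [_ E]].
- intros; apply H.
- intros x _. apply continuity_pt_filterlim.
  apply (ex_derive_continuous (V := R_NormedModule) f). exists (df x). apply H.
- rewrite E, Rabs_mult. generalize (H1 c) (Rabs_pos (b - a)) (Rabs_pos (df c)). nra.
Qed.

Lemma Cmod_cis_diff (a b : R) : (Cmod (cis b - cis a) <= 2 * Rabs (b - a))%R.
Proof.
apply Rle_trans with (1 := Cmod_le_Re_Im _).
assert (H1 : (Rabs (cos b - cos a) <= Rabs (b - a))%R).
{ apply (lipschitz_of_derive_le_1 cos (fun t => - sin t)%R). apply is_derive_cos.
  intros t. rewrite Rabs_Ropp. apply Rabs_le. generalize (SIN_bound t). lra. }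
assert (H2 : (Rabs (sin b - sin a) <= Rabs (b - a))%R).
{ apply (lipschitz_of_derive_le_1 sin cos). apply is_derive_sin.
  intros t. apply Rabs_le. generalize (COS_bound t). lra. }
change (Re (cis b - cis a)) with (cos b - cos a)%R.
change (Im (cis b - cis a)) with (sin b - sin a)%R. lra.
Qed.

(** The transform is Lipschitz: changing the frequency from [f] to [g] changes the exponential at
    [t] by at most [4 * PI * |t| * |g - f|], and [t * phi t] is integrable. *)
Lemma fourier_continuousC (phi : R -> C) : schwartz phi -> continuousC (fourier phi).
Proof.
intros H.
(* Domination of [t * phi t] by [lor] uses its moments up to order 2, hence order 3 for [phi]. *)
destruct (schwartz_seminorms phi 3 0 H) as [B HB].
assert (Hc := schwartz_continuousC _ H).
assert (D : dominatedR (2 * B) (fun t => RtoC t * phi t)).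
{ apply dominatedR_of_moments. intros i t Hi. rewrite Cmod_mult, Cmod_R, <- Rmult_assoc.
  replace (Rabs t ^ i * Rabs t)%R with (Rabs t ^ S i)%R by (simpl; ring).
  rewrite <- (CDerive_n_0 phi t). apply HB; lia. }
assert (D0 : dominatedR (2 * B) phi).
{ apply (seminorms_dominatedR_0 0). intros i j t Hi Hj. apply HB; lia. }
assert (HB0 := dominatedR_nonneg _ _ D).
assert (L : forall f g, (Cmod (fourier phi g - fourier phi f) <=
    (4 * PI * (2 * B) * PI) * Rabs (g - f))%R).
{ intros f g. unfold fourier.
  assert (Cf := fourier_integrand_continuousC phi f Hc).
  assert (Cg := fourier_integrand_continuousC phi g Hc).
  assert (Df := fourier_integrand_dominatedR _ phi f D0).
  assert (Dg := fourier_integrand_dominatedR _ phi g D0).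
  assert (Cf' : continuousC (fun t => -(1) * (phi t * cis (- (2 * PI * f * t))))).
  { intros t. apply continuous_C_mult. apply continuousC_const. apply Cf. }
  replace (Cintegral (fun t => phi t * cis (- (2 * PI * g * t))) -
           Cintegral (fun t => phi t * cis (- (2 * PI * f * t))))
    with (Cintegral (fun t => phi t * cis (- (2 * PI * g * t)) +
            -(1) * (phi t * cis (- (2 * PI * f * t))))).
  - replace (4 * PI * (2 * B) * PI * Rabs (g - f))%R
      with ((4 * PI * Rabs (g - f) * (2 * B)) * PI)%R by ring.
    apply Cintegral_bound.
    + intros t. apply continuous_C_plus. apply Cg. apply Cf'.
    + intros t.
      replace (phi t * cis (- (2 * PI * g * t)) + -(1) * (phi t * cis (- (2 * PI * f * t))))
        with (phi t * (cis (- (2 * PI * g * t)) - cis (- (2 * PI * f * t)))) by ring.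
      rewrite Cmod_mult.
      apply Rle_trans with (Cmod (phi t) * (2 * Rabs (- (2 * PI * g * t) - - (2 * PI * f * t))))%R.
      apply Rmult_le_compat_l. apply Cmod_ge_0. apply Cmod_cis_diff.
      replace (- (2 * PI * g * t) - - (2 * PI * f * t))%R with ((2 * PI) * (t * - (g - f)))%R by ring.
      rewrite !Rabs_mult, Rabs_Ropp, (Rabs_pos_eq 2), (Rabs_pos_eq PI)
        by (generalize PI_RGT_0; lra).
      generalize (D t). rewrite Cmod_mult, Cmod_R. intros Dt.
      replace (Cmod (phi t) * (2 * (2 * PI * (Rabs t * Rabs (g - f)))))%R
        with ((4 * PI * Rabs (g - f)) * (Rabs t * Cmod (phi t)))%R by ring.
      rewrite (Rmult_assoc (4 * PI * Rabs (g - f))).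
      apply Rmult_le_compat_l; [|exact Dt].
      apply Rmult_le_pos. generalize PI_RGT_0; lra. apply Rabs_pos.
  - rewrite (Cintegral_plus _ _ _ _ Cg Cf' Dg
      (dominatedR_mult _ (Cmod (-(1))) (fun _ => -(1)) _ (fun _ => Rle_refl _) Df)).
    rewrite (Cintegral_scal _ (-(1)) _ Cf Df). ring. }
intros f. apply continuous_C_eps. intros eps He.
set (K := (4 * PI * (2 * B) * PI)%R) in *.
assert (HK : (0 <= K)%R).
{ assert (HP := PI_RGT_0). unfold K. apply Rmult_le_pos; [apply Rmult_le_pos; lra|lra]. }
exists (eps / (K + 1))%R. split. apply Rdiv_lt_0_compat; lra.
intros g Hg. apply Rle_lt_trans with (1 := L f g).
apply Rmult_lt_compat_r with (r := (K + 1)%R) in Hg; [|lra].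
unfold Rdiv in Hg. rewrite Rmult_assoc, Rinv_l in Hg by lra.
generalize (Rabs_pos (g - f)). lra.
Qed.

(** * Functionals of finite order and temperedness *)

(** Order zero with polynomial weight: the functional is tested on all continuous functions of decay
    [m]. It can thus be evaluated at [phi] and at [fourier phi] alike, and this single property
    yields temperedness of [T] and of its Fourier transform. *)
Definition linear_bounded (m : nat) (K : R) (T : distr) : Prop :=
  (forall (a : C) (p q : R -> C) (Bp Bq : R), continuousC p -> continuousC q ->
     decays m Bp p -> decays m Bq q ->
     T (fun t => a * p t + q t) = a * T p + T q) /\
  (forall (p : R -> C) (B : R), continuousC p -> decays m B p -> (Cmod (T p) <= K * B)%R).

Lemma tempered_linear_bounded (m : nat) (K : R) (T : distr) :
  linear_bounded m K T -> tempered T.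
Proof.
intros [HL HB]. split.
- intros a phi psi Hphi Hpsi.
  destruct (schwartz_seminorms phi m 0 Hphi) as [B1 H1].
  destruct (schwartz_seminorms psi m 0 Hpsi) as [B2 H2].
  eapply HL; try (apply schwartz_continuousC; assumption); eapply schwartz_decays; eassumption.
- exists m, (K * (2 ^ m * 2))%R. intros phi B Hphi HS.
  replace (K * (2 ^ m * 2) * B)%R with (K * (2 ^ m * (2 * B)))%R by ring.
  apply HB. apply schwartz_continuousC, Hphi. apply schwartz_decays.
  intros i j t Hi Hj. apply HS; lia.
Qed.

Lemma tempered_fourierD (m : nat) (K : R) (T : distr) :
  linear_bounded m K T -> tempered (fourierD T).
Proof.
intros [HL HB]. split.
- intros a phi psi Hphi Hpsi. unfold fourierD.
  destruct (schwartz_seminorms phi 2 m Hphi) as [B1 H1].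
  destruct (schwartz_seminorms psi 2 m Hpsi) as [B2 H2].
  replace (fourier (fun t => a * phi t + psi t))
    with (fun f => a * fourier phi f + fourier psi f).
  + eapply HL; try (apply fourier_continuousC; assumption); eapply fourier_decays; eassumption.
  + apply functional_extensionality. intros f. symmetry.
    eapply fourier_linear; try (apply schwartz_continuousC; assumption);
      eapply seminorms_dominatedR_0; eassumption.
(* Decay [m] of [fourier phi] costs two moments and [m] derivatives of [phi]; [tempered] has one
   index for both, and [m + 2] covers them. *)
- exists (m + 2)%nat, (K * (2 ^ m * (2 * (2 * PI))))%R. intros phi B Hphi HS.
  replace (K * (2 ^ m * (2 * (2 * PI))) * B)%R with (K * (2 ^ m * (2 * (2 * B * PI))))%R by ring.
  apply HB. apply fourier_continuousC, Hphi. apply fourier_decays. exact Hphi.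
  intros i j t Hi Hj. apply HS; lia.
Qed.

Lemma tempered_scalD (c : C) (T : distr) : tempered T -> tempered (scalD c T).
Proof.
intros [HL [m [K HB]]]. split.
- intros a phi psi H1 H2. unfold scalD. rewrite HL by assumption. ring.
- exists m, (Cmod c * K)%R. intros phi B H HS. unfold scalD.
  rewrite Cmod_mult, Rmult_assoc. apply Rmult_le_compat_l. apply Cmod_ge_0.
  apply HB; assumption.
Qed.

Definition slow_growth (m : nat) (A : R) (x : R -> C) : Prop :=
  (0 <= A)%R /\ forall t, (Cmod (x t) <= A * (1 + Rabs t) ^ m)%R.

Lemma signal_slow_growth (x : R -> C) : signal x -> exists m A, slow_growth m A x.
Proof.
intros [_ [m [A H]]]. exists m, A. split; [|exact H].
generalize (H 0%R) (Cmod_ge_0 (x 0%R)). rewrite Rabs_R0, Rplus_0_r, pow1. lra.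
Qed.

(** Of the decay [m + 2], [m] orders cancel the growth of [x] and the remaining two supply [lor]. *)
Lemma slow_growth_dominatedR (m : nat) (A B : R) (x psi : R -> C) :
  slow_growth m A x -> decays (m + 2) B psi -> dominatedR (A * B) (fun t => x t * psi t).
Proof.
intros [HA Hx] H t. apply le_lor. rewrite Cmod_mult.
specialize (Hx t). specialize (H t). rewrite pow_add in H.
set (s := Rabs t) in *. assert (Hs : (0 <= s)%R) by apply Rabs_pos.
assert (Ht : (1 + t ^ 2 <= (1 + s) ^ 2)%R) by (unfold s; rewrite <- (pow2_abs t); fold s; nra).
assert (P := Cmod_ge_0 (psi t)). assert (P' := Cmod_ge_0 (x t)).
assert (Hm : (0 <= (1 + s) ^ m)%R) by (apply pow_le; lra).
apply Rle_trans with (A * ((1 + s) ^ m * (1 + s) ^ 2 * Cmod (psi t)))%R.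
- replace (A * ((1 + s) ^ m * (1 + s) ^ 2 * Cmod (psi t)))%R
    with ((A * (1 + s) ^ m * Cmod (psi t)) * (1 + s) ^ 2)%R by ring.
  apply Rmult_le_compat; try nra.
- apply Rmult_le_compat_l; assumption.
Qed.

Lemma dominatedZ_samples (b B : R) (f : R -> C) :
  dominatedR B f -> dominatedZ b B (fun k => f (IZR k * b)%R).
Proof. intros H k. rewrite (Rmult_comm b). apply H. Qed.

(** The common shape of all the pulse trains: step [1 / fs] with gains as weights on the time side,
    step [fs / N] with DFT values as weights and [x = 1] for the comb. *)
Definition samples (b : R) (c : Z -> C) (x : R -> C) : distr :=
  fun psi => sumZ (fun k => c k * (x (IZR k * b)%R * psi (IZR k * b)%R)).

Lemma samples_linear_bounded (b M : R) (c : Z -> C) (m : nat) (A : R) (x : R -> C) :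
  (0 < b)%R -> (forall k, (Cmod (c k) <= M)%R) -> slow_growth m A x ->
  linear_bounded (m + 2) (M * A * (1 + PI / b)) (samples b c x).
Proof.
intros Hb Hc Hx.
assert (D : forall p B, decays (m + 2) B p ->
  dominatedZ b (M * (A * B)) (fun k => c k * (x (IZR k * b)%R * p (IZR k * b)%R))).
{ intros p B Hp. apply dominatedZ_mult. exact Hc.
  apply (dominatedZ_samples b _ (fun t => x t * p t)).
  apply (slow_growth_dominatedR m A B); assumption. }
split.
- intros a p q Bp Bq _ _ Hp Hq. unfold samples.
  rewrite <- (sumZ_scal b _ a _ Hb (D p Bp Hp)).
  rewrite <- (sumZ_plus b _ _ _ _ Hb
    (dominatedZ_mult b _ (Cmod a) (fun _ => a) _ (fun _ => Rle_refl _) (D p Bp Hp)) (D q Bq Hq)).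
  apply sumZ_ext. intros k. ring.
- intros p B _ Hp.
  replace (M * A * (1 + PI / b) * B)%R with (M * (A * B) * (1 + PI / b))%R by ring.
  apply sumZ_bound. exact Hb. apply D, Hp.
Qed.

Lemma regD_linear_bounded (m : nat) (A : R) (x : R -> C) :
  continuousC x -> slow_growth m A x -> linear_bounded (m + 2) (A * PI) (regD x).
Proof.
intros Cx Hx.
assert (CM : forall p, continuousC p -> continuousC (fun t => x t * p t)).
{ intros p Cp t. apply continuous_C_mult. apply Cx. apply Cp. }
split.
- intros a p q Bp Bq Cp Cq Hp Hq. unfold regD.
  assert (Dp := slow_growth_dominatedR m A Bp x p Hx Hp).
  assert (Dq := slow_growth_dominatedR m A Bq x q Hx Hq).
  rewrite <- (Cintegral_scal _ a _ (CM p Cp) Dp).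
  rewrite <- (Cintegral_plus (Cmod a * (A * Bp)) (A * Bq)).
  + apply Cintegral_ext. intros t. ring.
  + intros t. apply continuous_C_mult. apply continuousC_const. apply CM, Cp.
  + apply CM, Cq.
  + apply (dominatedR_mult _ (Cmod a) (fun _ => a)). intros; lra. exact Dp.
  + exact Dq.
- intros p B Cp Hp. replace (A * PI * B)%R with (A * B * PI)%R by ring.
  apply Cintegral_bound. apply CM, Cp. apply (slow_growth_dominatedR m); assumption.
Qed.

Lemma sumZ_one_plus (d B M : R) (g : Z -> R) (v : Z -> C) :
  (0 < d)%R -> (forall k, (Cmod (g k) <= M)%R) -> dominatedZ d B v ->
  sumZ (fun k => RtoC (1 + g k) * v k) = sumZ v + sumZ (fun k => RtoC (g k) * v k).
Proof.
intros Hd Hg Hv.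
rewrite <- (sumZ_plus d _ _ _ _ Hd Hv (dominatedZ_mult d B M (fun k => RtoC (g k)) v Hg Hv)).
apply sumZ_ext. intros k. rewrite RtoC_plus. ring.
Qed.

(** * Periodic sequences and the DFT *)

Lemma modN_lt (N : nat) (k : Z) : (1 <= N)%nat -> (modN N k < N)%nat.
Proof.
intros HN. unfold modN. generalize (Z.mod_pos_bound k (Z.of_nat N) ltac:(lia)). lia.
Qed.

Lemma modN_add_mul (N p : nat) (m : Z) : (p < N)%nat -> modN N (Z.of_nat p + m * Z.of_nat N) = p.
Proof.
intros Hp. unfold modN. rewrite Z.mod_add, Z.mod_small by lia. apply Nat2Z.id.
Qed.

Lemma modN_bounded (N : nat) (v : nat -> C) :
  (1 <= N)%nat -> exists M, forall k, (Cmod (v (modN N k)) <= M)%R.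
Proof.
intros HN.
assert (K : forall n, exists M, forall p, (p < n)%nat -> (Cmod (v p) <= M)%R).
{ induction n as [|n [M HM]].
  - exists 0%R. intros; lia.
  - exists (Rmax M (Cmod (v n))). intros p Hp. destruct (Nat.eq_dec p n) as [->|Hne].
    + apply Rmax_r.
    + apply Rle_trans with (2 := Rmax_l _ _). apply HM. lia. }
destruct (K N) as [M HM]. exists M. intros k. apply HM, modN_lt, HN.
Qed.

(** Writing [k = N * q + r], the exponents for [k] and [r] differ by [2 * PI * q * p], a whole
    number of turns. The reduction of the index can therefore be removed before the substitution in
    the integral. *)
Lemma dft_modN (N : nat) (u : nat -> C) (k : Z) :
  (1 <= N)%nat ->
  dft N u (modN N k) =
  / RtoC (INR N) * csum (fun p => cis (- (2 * PI * IZR k * INR p / INR N)) * u p) N.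
Proof.
intros HN. unfold dft. rewrite sum_n_csum. replace (S (N - 1)) with N by lia.
f_equal. apply csum_ext. intros p Hp. f_equal.
assert (HN0 : (INR N <> 0)%R) by (apply not_0_INR; lia).
assert (E : (IZR k = INR N * IZR (k / Z.of_nat N) + INR (modN N k))%R).
{ unfold modN. rewrite !INR_IZR_INZ, Z2Nat.id, <- mult_IZR, <- plus_IZR.
  - f_equal. apply Z.div_mod. lia.
  - apply Z.mod_pos_bound. lia. }
rewrite E.
replace (- (2 * PI * INR (modN N k) * INR p / INR N))%R
  with (- (2 * PI * (INR N * IZR (k / Z.of_nat N) + INR (modN N k)) * INR p / INR N)
        + 2 * PI * IZR (k / Z.of_nat N * Z.of_nat p))%R.
- rewrite cis_add, cis_2PI_IZR. ring.
- rewrite mult_IZR, <- INR_IZR_INZ. field. exact HN0.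
Qed.

(** * Convolution with the comb *)

Lemma fourierD_regD_shift (x phi : R -> C) (s : R) :
  schwartz phi ->
  fourierD (regD x) (fun f => phi (f + s)%R) =
  Cintegral (fun t => cis (2 * PI * t * s) * (x t * fourier phi t)).
Proof.
intros H. destruct (schwartz_dominatedR phi H) as [B HB].
apply Cintegral_ext. intros t.
rewrite (fourier_shift B s phi t (schwartz_continuousC _ H) HB). ring.
Qed.

(** Under [t = (N / fs) * u + p / fs] the wave [k * u] becomes the frequency [k * fs / N] in [t], up
    to a constant phase, and that phase is exactly the DFT exponential at [(k, p)]. *)
Lemma Cintegral_wave_rescaled (N : nat) (fs B : R) (p : nat) (k : Z) (h : R -> C) :
  (1 <= N)%nat -> (0 < fs)%R -> continuousC h -> dominatedR B h ->
  RtoC (INR N / fs) *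
    Cintegral (fun u => wave k u * h (INR N / fs * u + INR p / fs)%R) =
  cis (- (2 * PI * IZR k * INR p / INR N)) *
    Cintegral (fun t => cis (2 * PI * t * (IZR k * (fs / INR N))) * h t).
Proof.
intros HN Hfs Ch Hh.
assert (HN0 : (0 < INR N)%R) by (apply lt_0_INR; lia).
assert (HT : (0 < INR N / fs)%R) by (apply Rdiv_lt_0_compat; assumption).
assert (Cc : continuousC (fun t => cis (2 * PI * t * (IZR k * (fs / INR N))))).
{ intros t. apply (continuous_ext (fun t => cis (2 * PI * (IZR k * (fs / INR N)) * t + 0))).
  intros s. f_equal. ring. apply continuousC_cis. }
assert (C1 : continuousC (fun t => cis (2 * PI * t * (IZR k * (fs / INR N))) * h t)).
{ intros t. apply continuous_C_mult. apply Cc. apply Ch. }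
assert (D1 : dominatedR (1 * B) (fun t => cis (2 * PI * t * (IZR k * (fs / INR N))) * h t)).
{ apply dominatedR_mult. intros t. rewrite Cmod_cis. lra. exact Hh. }
set (z := cis (- (2 * PI * IZR k * INR p / INR N))).
rewrite <- (Cintegral_scal _ z _ C1 D1).
set (F := fun t => z * (cis (2 * PI * t * (IZR k * (fs / INR N))) * h t)).
rewrite <- (Cintegral_comp_lin (Cmod z * (1 * B)) (INR N / fs) (INR p / fs) F HT).
- f_equal. apply Cintegral_ext. intros u. unfold F, z, wave.
  rewrite Cmult_assoc, <- cis_add. f_equal. f_equal. field. split; lra.
- intros t. apply continuous_C_mult. apply continuousC_const. apply C1.
- apply (dominatedR_mult _ (Cmod z) (fun _ => z)). intros; lra. exact D1.
Qed.

(** Collects the domination constants of finitely many residues into one function, by induction and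
    without a choice principle. *)
Lemma finite_choice (P : nat -> R -> Prop) (n : nat) :
  (forall p, exists b, P p b) -> exists B, forall p, (p < n)%nat -> P p (B p).
Proof.
intros H. induction n as [|n [B HB]].
- exists (fun _ => 0%R). intros; lia.
- destruct (H n) as [b Hb].
  exists (fun p => if Nat.eq_dec p n then b else B p). intros p Hp.
  destruct (Nat.eq_dec p n) as [->|Hne]. exact Hb. apply HB. lia.
Qed.

(** The constants cancel: the strength [fs] of the comb, the [1 / N] of the normalized DFT and the
    Jacobian [N / fs] of the substitution have product 1, so each residue is left with weight
    [g p]. *)
Lemma comb_cutoff_expand (N : nat) (fs B Beta : R) (n : nat) (g : nat -> C) (eta h : R -> C) :
  (1 <= N)%nat -> (0 < fs)%R -> continuousC h -> dominatedR B h -> dominatedR Beta eta ->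
  RtoC fs * sumZ (fun k => dft N g (modN N k) *
    (eta (IZR k * (fs / INR N) / INR (S n))%R *
     Cintegral (fun t => cis (2 * PI * t * (IZR k * (fs / INR N))) * h t))) =
  csum (fun p => g p * sumZ (fun k => eta (IZR k * (fs / INR N) / INR (S n))%R *
     Cintegral (fun u => wave k u * h (INR N / fs * u + INR p / fs)%R))) N.
Proof.
intros HN Hfs Ch Hh He.
assert (HN0 : (0 < INR N)%R) by (apply lt_0_INR; lia).
assert (HS : (0 < INR (S n))%R) by (apply lt_0_INR; lia).
assert (HT : (0 < INR N / fs)%R) by (apply Rdiv_lt_0_compat; assumption).
set (a := (fs / INR N)%R).
set (d := (a / INR (S n))%R).
assert (Hd : (0 < d)%R) by (apply Rdiv_lt_0_compat; [apply Rdiv_lt_0_compat|]; assumption).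
set (J := fun p k => Cintegral (fun u => wave k u * h (INR N / fs * u + INR p / fs)%R)).
set (e := fun k : Z => eta (IZR k * a / INR (S n))%R).
assert (De : dominatedZ d Beta e).
{ intros k. unfold e. replace (IZR k * a / INR (S n))%R with (d * IZR k)%R
    by (unfold d; field; lra). apply He. }
assert (Dp : forall p, exists B', dominatedZ d B' (fun k => e k * J p k)).
{ intros p.
  assert (D := dominatedR_comp_lin B (INR N / fs) (INR p / fs) h HT Hh).
  assert (BJ : exists M, forall k, (Cmod (J p k) <= M)%R).
  { revert D. generalize (B * (1 + 2 / (INR N / fs) ^ 2 +
      2 * (INR p / fs) ^ 2 / (INR N / fs) ^ 2))%R. intros Bp D.
    exists (1 * Bp * PI)%R. intros k. apply Cintegral_bound.
    - intros t. apply continuous_C_mult. apply wave_continuousC.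
      apply continuous_C_comp_lin, Ch.
    - apply (dominatedR_mult Bp 1%R (wave k)). intros t. rewrite Cmod_wave. lra. exact D. }
  destruct BJ as [M HM]. exists (M * Beta)%R. intros k. rewrite Cmult_comm.
  apply (dominatedZ_mult d Beta M (J p) e HM De). }
assert (Dg : forall p, exists B', dominatedZ d B' (fun k => (/ RtoC fs * g p) * (e k * J p k))).
{ intros p. destruct (Dp p) as [B' HB']. eexists.
  apply (dominatedZ_mult d B' (Cmod (/ RtoC fs * g p)) (fun _ => / RtoC fs * g p)).
  intros; apply Rle_refl. exact HB'. }
assert (Hfs0 : RtoC fs <> 0) by (intros E; apply RtoC_inj in E; lra).
assert (HNC : RtoC (INR N) <> 0) by (intros E; apply RtoC_inj in E; lra).
(* The factor [/ RtoC fs] is [1 / N] times the Jacobian [N / fs]; the outer [fs] removes it once sum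
   and residues have been exchanged. *)
transitivity (RtoC fs * sumZ (fun k => csum (fun p => (/ RtoC fs * g p) * (e k * J p k)) N)).
- f_equal. apply sumZ_ext. intros k. rewrite (dft_modN N g k HN).
  fold a. fold (e k).
  set (I := Cintegral (fun t => cis (2 * PI * t * (IZR k * a)) * h t)).
  transitivity (csum (fun p => (/ RtoC (INR N) * (e k * I)) *
     (cis (- (2 * PI * IZR k * INR p / INR N)) * g p)) N).
  + rewrite csum_scal. ring.
  + apply csum_ext. intros p _.
    assert (EJ := Cintegral_wave_rescaled N fs B p k h HN Hfs Ch Hh).
    fold a in EJ. fold I in EJ. fold (J p k) in EJ.
    rewrite RtoC_div in EJ by lra.
    transitivity (/ RtoC (INR N) * (e k * g p) *
      (cis (- (2 * PI * IZR k * INR p / INR N)) * I)). ring.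
    rewrite <- EJ. field. split; assumption.
- assert (EB : exists B' : nat -> R, forall p, (p < N)%nat ->
     dominatedZ d (B' p) (fun k => (/ RtoC fs * g p) * (e k * J p k))).
  { apply (finite_choice (fun p b =>
      dominatedZ d b (fun k => (/ RtoC fs * g p) * (e k * J p k)))), Dg. }
  destruct EB as [B' HB'].
  rewrite (sumZ_csum d B' (fun p k => (/ RtoC fs * g p) * (e k * J p k)) N Hd HB').
  rewrite <- csum_scal. apply csum_ext. intros p _.
  destruct (Dp p) as [b Hb].
  rewrite (sumZ_scal d b _ _ Hd Hb). fold a.
  change (sumZ (fun k => eta (IZR k * a / INR (S n))%R * _)) with (sumZ (fun k => e k * J p k)).
  field. exact Hfs0.
Qed.

(** The point [(N / fs) * m + p / fs] is the sampling instant of index [p + m * N], whose residue is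
    [p]. *)
Lemma comb_limit_regroup (N : nat) (fs B : R) (g : nat -> C) (h : R -> C) :
  (1 <= N)%nat -> (0 < fs)%R -> dominatedR B h ->
  csum (fun p => g p * sumZ (fun m => h (INR N / fs * IZR m + INR p / fs)%R)) N =
  sumZ (fun k => g (modN N k) * h (IZR k * / fs)%R).
Proof.
intros HN Hfs Hh.
assert (HN0 : (0 < INR N)%R) by (apply lt_0_INR; lia).
assert (HT : (0 < INR N / fs)%R) by (apply Rdiv_lt_0_compat; assumption).
assert (Hi : (0 < / fs)%R) by (apply Rinv_0_lt_compat, Hfs).
destruct (modN_bounded N g HN) as [M HM].
assert (D : forall p, dominatedZ 1 (B * (1 + 2 / (INR N / fs) ^ 2 + 2 * (INR p / fs) ^ 2 / (INR N / fs) ^ 2))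
   (fun m => h (INR N / fs * IZR m + INR p / fs)%R)).
{ intros p k. rewrite Rmult_1_l.
  apply (dominatedR_comp_lin B (INR N / fs) (INR p / fs) h HT Hh). }
assert (E : forall p m, (p < N)%nat ->
  g (modN N (Z.of_nat p + m * Z.of_nat N)) * h (IZR (Z.of_nat p + m * Z.of_nat N) * / fs)%R =
  g p * h (INR N / fs * IZR m + INR p / fs)%R).
{ intros p m Hp. rewrite modN_add_mul by exact Hp. f_equal. f_equal.
  rewrite plus_IZR, mult_IZR, <- !INR_IZR_INZ. field. lra. }
transitivity (csum (fun p => sumZ (fun m =>
  g (modN N (Z.of_nat p + m * Z.of_nat N)) * h (IZR (Z.of_nat p + m * Z.of_nat N) * / fs)%R)) N).
- apply csum_ext. intros p Hp. rewrite <- (sumZ_scal 1 _ (g p) _ Rlt_0_1 (D p)).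
  apply sumZ_ext. intros m. symmetry. apply E, Hp.
- apply (sumZ_residues N (/ fs) (M * B) (fun k => g (modN N k) * h (IZR k * / fs)%R) 1
    (fun p => Cmod (g p) *
      (B * (1 + 2 / (INR N / fs) ^ 2 + 2 * (INR p / fs) ^ 2 / (INR N / fs) ^ 2)))%R); try assumption.
  + lra.
  + apply (dominatedZ_mult (/ fs) B M (fun k => g (modN N k))). exact HM.
    apply dominatedZ_samples, Hh.
  + intros p Hp m. cbv beta. rewrite (E p m Hp). revert m.
    apply (dominatedZ_mult 1 _ (Cmod (g p)) (fun _ => g p)). intros; lra. apply D.
Qed.

Lemma comb_convolution_limit (N : nat) (fs B : R) (g : nat -> C) (eta h : R -> C) :
  (1 <= N)%nat -> (0 < fs)%R -> continuousC h -> dominatedR B h ->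
  schwartz eta -> eta 0%R = 1 ->
  tendsC (fun n => RtoC fs * sumZ (fun k => dft N g (modN N k) *
    (eta (IZR k * (fs / INR N) / INR (S n))%R *
     Cintegral (fun t => cis (2 * PI * t * (IZR k * (fs / INR N))) * h t))))
   (sumZ (fun k => g (modN N k) * h (IZR k * / fs)%R)).
Proof.
intros HN Hfs Ch Hh He He0.
assert (HN0 : (0 < INR N)%R) by (apply lt_0_INR; lia).
assert (HT : (0 < INR N / fs)%R) by (apply Rdiv_lt_0_compat; assumption).
assert (Ha : (0 < fs / INR N)%R) by (apply Rdiv_lt_0_compat; assumption).
destruct (schwartz_dominatedR eta He) as [Beta HBeta].
destruct (schwartz_second_difference eta (fs / INR N) He) as [B2 HB2].
rewrite <- (comb_limit_regroup N fs B g h HN Hfs Hh).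
eapply tendsC_ext.
{ intros n. symmetry. apply (comb_cutoff_expand N fs B Beta n g eta h); assumption. }
apply (tendsC_csum (fun n p => g p * sumZ (fun k => eta (IZR k * (fs / INR N) / INR (S n))%R *
     Cintegral (fun u => wave k u * h (INR N / fs * u + INR p / fs)%R)))).
intros p _. apply tendsC_scal.
eapply poisson_summability; try eassumption.
- apply continuous_C_comp_lin, Ch.
- apply (dominatedR_comp_lin B); assumption.
Qed.

Theorem mainTheorem2 (N : nat) (fs : R) (x : R -> C) (g : nat -> R)
    (hN : (1 <= N)%nat) (hfs : (0 < fs)%R) (hx : signal x) :
  let X := fourierD (regD x) in
  let yid := mulD x (sumZD (fun k => diracD (IZR k / fs))) in
  let yg := mulD x (sumZD (fun k =>
              scalD (RtoC (1 + g (modN N k))) (diracD (IZR k / fs)))) in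
  let gt := dft N (fun n => RtoC (g n)) in
  let comb := scalD (RtoC fs) (sumZD (fun k =>
                scalD (gt (modN N k)) (diracD (IZR k * (fs / INR N))))) in
  tempered yid /\ tempered yg /\
  eqD yg (addD yid (mulD x (sumZD (fun k =>
            scalD (RtoC (g (modN N k))) (diracD (IZR k / fs)))))) /\
  exists XconvComb : distr,
    is_convD X comb XconvComb /\
    eqD (fourierD yg) (addD (fourierD yid) XconvComb).
Proof.
intros X yid yg gt comb.
assert (HN0 : (0 < INR N)%R) by (apply lt_0_INR; lia).
assert (Hi : (0 < / fs)%R) by (apply Rinv_0_lt_compat, hfs).
assert (Ha : (0 < fs / INR N)%R) by (apply Rdiv_lt_0_compat; assumption).
destruct (signal_slow_growth x hx) as [m [A Hx]].
assert (Cx : continuousC x) by apply (proj1 hx).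
destruct (modN_bounded N (fun n => RtoC (g n)) hN) as [Mg HMg].
destruct (modN_bounded N (fun n => RtoC (1 + g n)) hN) as [M1 HM1].
destruct (modN_bounded N gt hN) as [Mt HMt].
set (ge := mulD x (sumZD (fun k => scalD (RtoC (g (modN N k))) (diracD (IZR k / fs))))).
assert (LBg := samples_linear_bounded (/ fs) Mg (fun k => RtoC (g (modN N k))) m A x Hi HMg Hx).
assert (LB1 := samples_linear_bounded (/ fs) M1 (fun k => RtoC (1 + g (modN N k))) m A x Hi HM1 Hx).
assert (LB0 := samples_linear_bounded (/ fs) 1 (fun _ => 1) m A x Hi
  (fun _ => Req_le _ _ Cmod_1) Hx).
assert (Eid : samples (/ fs) (fun _ => 1) x = yid).
{ apply functional_extensionality. intros psi. apply sumZ_ext. intros k. apply Cmult_1_l. }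
(* Stated for every function of sufficient decay, since it is applied to test functions for the
   identity in time and to their Fourier transforms for the identity in frequency. *)
assert (split : forall psi B, decays (m + 2) B psi -> yg psi = yid psi + ge psi).
{ intros psi B Hpsi.
  apply (sumZ_one_plus (/ fs) (A * B) Mg (fun k => g (modN N k))
    (fun k => x (IZR k * / fs)%R * psi (IZR k * / fs)%R) Hi HMg).
  apply (dominatedZ_samples (/ fs) _ (fun t => x t * psi t)).
  apply (slow_growth_dominatedR m); assumption. }
split; [|split; [|split]].
- rewrite <- Eid. exact (tempered_linear_bounded _ _ _ LB0).
- exact (tempered_linear_bounded _ _ _ LB1).
- intros phi Hphi. destruct (schwartz_seminorms phi (m + 2) 0 Hphi) as [B HB].
  exact (split phi _ (schwartz_decays _ phi B HB)).
(* The witness is the transform of the gain error. The spectral identity is then additivity, and the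
   substance lies in showing that this distribution is the convolution of [X] with the comb. *)
- exists (fourierD ge). split.
  + split; [|split; [|split]].
    * exact (tempered_fourierD _ _ _ (regD_linear_bounded m A x Cx Hx)).
    * apply tempered_scalD.
      assert (H1 : slow_growth 0 1 (fun _ => 1)).
      { split. lra. intros t. rewrite Cmod_1. simpl. lra. }
      assert (LBt := samples_linear_bounded (fs / INR N) Mt (fun k => gt (modN N k)) 0 1
        (fun _ => 1) Ha HMt H1).
      replace (sumZD (fun k => scalD (gt (modN N k)) (diracD (IZR k * (fs / INR N)))))
        with (samples (fs / INR N) (fun k => gt (modN N k)) (fun _ => 1)).
      exact (tempered_linear_bounded _ _ _ LBt).
      apply functional_extensionality. intros psi. apply sumZ_ext. intros k.
      unfold scalD, diracD. ring.
    * exact (tempered_fourierD _ _ _ LBg).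
    * intros eta phi Heta Heta0 Hphi.
      destruct (schwartz_seminorms phi 2 (m + 2) Hphi) as [B HB].
      assert (Dphi := fourier_decays (m + 2) phi B Hphi HB).
      assert (Df := slow_growth_dominatedR m A _ x (fourier phi) Hx Dphi).
      apply filterlim_tendsC.
      (* Here [h = x * fourier phi]; the goal left by [tendsC_ext] is the pairing of [X] with the
         translate of [phi] at the comb points, supplied by [fourierD_regD_shift]. *)
      eapply tendsC_ext; [|eapply (fun B => comb_convolution_limit N fs B (fun n => RtoC (g n)) eta
        (fun t => x t * fourier phi t) hN hfs); try eassumption].
      -- intros n. apply (f_equal (Cmult fs)). apply sumZ_ext. intros k.
         apply (f_equal (Cmult _)), (f_equal (Cmult _)). symmetry.
         apply fourierD_regD_shift, Hphi.
      -- intros t. apply continuous_C_mult. apply Cx. apply fourier_continuousC, Hphi.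
  + intros phi Hphi. destruct (schwartz_seminorms phi 2 (m + 2) Hphi) as [B HB].
    exact (split (fourier phi) _ (fourier_decays _ phi B Hphi HB)).
Qed.
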